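(* Let $n\geq 2$ and let $Y=\widetilde{\bigvee}_{j\in\mathbb{N}}A_j$ be the shrinking wedge of a sequence $(A_j,a_j)$, $j\in\mathbb{N}$, of based spaces, with wedge point $b_0$. Then the canonical homomorphism \[\phi:\pi_n(Y,b_0)\to \prod_{j\in\mathbb{N}}\pi_n(A_j,a_j),\quad \phi([f])=([r_1\circ f],[r_2\circ f],[r_3\circ f],\dots )\] is a split epimorphism. Moreover, if $(A_j,a_j)$ is sequentially $(n-1)$-connected for all $j\in\mathbb{N}$, then $\phi$ is an isomorphism.
   Context: All spaces Hausdorff. The shrinking wedge $\widetilde{\bigvee}_j(A_j,a_j)$ is the one-point union $\bigvee_j A_j$ (all $a_j$ identified to $b_0$) with the topology in which $U$ is open iff $U\cap A_j$ is open in $A_j$ for all $j$ and, whenever $b_0\in U$, $A_j\subseteq U$ for all but finitely many $j$. $r_j:Y\to A_j$ collapses all $A_i$, $i\ne j$, to $a_j$. $\mathbb{H}_0=\{0\}\cup\{1/m\}$ based at $0$ and, for $k\ge1$, $\mathbb{H}_k$ is the shrinking wedge of countably many copies of $S^k$. $(A,a)$ is sequentially $m$-connected if the set of based homotopy classes $[(\mathbb{H}_k,b_0),(A,a)]$ is a singleton for each $0\le k\le m$. *)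

(* Defs.v *)
From HB Require Import structures.
From mathcomp Require Import all_boot all_order all_algebra.
From mathcomp Require Import all_classical all_reals all_analysis.
From mathcomp Require Import Rstruct Rstruct_topology.
From mathcomp Require Import wedge_sigT.

Set Implicit Arguments.
Unset Strict Implicit.
Unset Printing Implicit Defensive.

Import Order.TTheory GRing.Theory Num.Theory.
Local Open Scope classical_set_scope.
Local Open Scope ring_scope.

Notation RR := Rdefinitions.R.

Section ShrinkingWedge.
Context (X : nat -> topologicalType) (p0 : forall i, X i).

Definition swedge : Type := wedge p0.
HB.instance Definition _ := Choice.on swedge.

Definition swedge_inj (i : nat) : X i -> swedge := @wedge_lift nat X p0 i.
Definition swedge_pt : swedge := swedge_inj (p0 0%N).

Definition swedge_open (U : set swedge) : Prop :=
  (forall i, open (swedge_inj (i:=i) @^-1` U)) /\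
  (U swedge_pt -> finite_set [set i | ~ (range (swedge_inj (i:=i)) `<=` U)]).

Lemma swedge_openT : swedge_open setT.
Proof.
split => [i|_]; first by rewrite preimage_setT; exact: openT.
by rewrite (_ : [set i | _] = set0) //; apply/seteqP; split => i //=; apply.
Qed.

Lemma swedge_openI : setI_closed swedge_open.
Proof.
move=> U V [oU fU] [oV fV]; split => [i|[Ub Vb]].
  by rewrite preimage_setI; apply: openI.
have fUV : finite_set ([set i | ~ (range (swedge_inj (i:=i)) `<=` U)] `|`
                        [set i | ~ (range (swedge_inj (i:=i)) `<=` V)]).
  by rewrite finite_setU; split; [exact: fU | exact: fV].
apply: (sub_finite_set _ fUV) => i /= nUV; rewrite /setU /=.
apply/not_andP => -[hU hV]; apply: nUV => y ry.
by split; [exact: hU | exact: hV].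
Qed.

Lemma swedge_open_bigU (I : Type) (f : I -> set swedge) :
  (forall i, swedge_open (f i)) -> swedge_open (\bigcup_i f i).
Proof.
move=> hf; split => [i|[i0 _ fb]].
  rewrite preimage_bigcup; apply: bigcup_open => k _; exact: (hf k).1.
apply: (sub_finite_set _ ((hf i0).2 fb)) => i /= nU; apply: contra_not nU.
by move=> sub y ry; exists i0 => //; exact: sub.
Qed.

Definition swedgeT : Type := swedge.
HB.instance Definition _ := Choice.on swedgeT.
HB.instance Definition _ := isOpenTopological.Build swedgeT
  swedge_openT swedge_openI swedge_open_bigU.

(* the retraction r_j : Y -> X j collapsing all X i, i <> j, to p0 j *)
Definition swedge_retr (j : nat) (y : swedgeT) : X j :=
  xget (p0 j) [set x | swedge_inj x = y].

End ShrinkingWedge.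

(* n-th homotopy group, presented by representatives:                  *)
(* maps (I^n, boundary) -> (A, a), homotopy rel boundary, and          *)
(* concatenation in the first coordinate.                              *)
Definition cube (n : nat) : set 'rV[RR]_n :=
  [set x | forall i, 0 <= x 0 i <= 1].
Arguments cube : clear implicits.
Definition cube_bdry (n : nat) : set 'rV[RR]_n :=
  [set x | cube n x /\ exists i, x 0 i = 0 \/ x 0 i = 1].
Arguments cube_bdry : clear implicits.

Definition unit_interval : set RR := [set t | 0 <= t <= 1].

Definition nloop (n : nat) (A : topologicalType) (a : A) (f : 'rV[RR]_n -> A) :=
  {within cube n, continuous f} /\ (forall x, cube_bdry n x -> f x = a).

(* homotopy rel boundary, i.e. equality in pi_n(A, a) *)
Definition nhomotopic (n : nat) (A : topologicalType) (a : A)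
    (f g : 'rV[RR]_n -> A) :=
  exists H : RR * 'rV[RR]_n -> A,
    [/\ {within unit_interval `*` cube n, continuous H},
        (forall x, cube n x -> H (0, x) = f x /\ H (1, x) = g x) &
        (forall t x, unit_interval t -> cube_bdry n x -> H (t, x) = a)].

(* first coordinate (for n >= 1) *)
Definition coord0 (n : nat) (x : 'rV[RR]_n) : RR :=
  \sum_(i < n | val i == 0%N) x 0 i.

Definition nconcat (n : nat) (A : Type) (f g : 'rV[RR]_n -> A) :
    'rV[RR]_n -> A :=
  fun x => if coord0 x <= 2^-1
           then f (\row_i (if val i == 0%N then 2 * x 0 i else x 0 i))
           else g (\row_i (if val i == 0%N then 2 * x 0 i - 1 else x 0 i)).

Definition based_homotopic (X A : topologicalType) (x0 : X) (a : A)
    (f g : X -> A) :=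
  exists H : RR * X -> A,
    [/\ {within unit_interval `*` setT, continuous H},
        (forall x, H (0, x) = f x /\ H (1, x) = g x) &
        (forall t, unit_interval t -> H (t, x0) = a)].

Definition based_map (X A : topologicalType) (x0 : X) (a : A) (f : X -> A) :=
  continuous f /\ f x0 = a.

Definition based_classes_trivial (X A : topologicalType) (x0 : X) (a : A) :=
  forall f g, based_map x0 a f -> based_map x0 a g -> based_homotopic x0 a f g.

Definition H0set : set RR := [set x | x = 0 \/ exists m : nat, x = (m.+1%:R)^-1].
Lemma H0set0 : (0 : RR) \in H0set.
Proof. by apply/mem_set; left. Qed.
Definition H0T : topologicalType := set_type H0set.
Definition H0pt : H0T := @exist _ (fun x => x \in H0set) 0 H0set0.

Definition sphere (k : nat) : set 'rV[RR]_k.+1 :=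
  [set x | \sum_i x 0 i ^+ 2 = 1].
Arguments sphere : clear implicits.
Definition sphere_e0 (k : nat) : 'rV[RR]_k.+1 := \row_i (val i == 0%N)%:R.
Lemma sphere_e0_in k : sphere_e0 k \in sphere k.
Proof.
apply/mem_set; rewrite /sphere /= big_ord_recl /sphere_e0 !mxE /= expr1n.
by rewrite big1 ?addr0 // => i _; rewrite mxE /= expr0n.
Qed.
Definition sphereT (k : nat) : topologicalType := set_type (sphere k).
Definition sphere_pt (k : nat) : sphereT k := @exist _ (fun x => x \in sphere k) _ (sphere_e0_in k).

Definition HkT (k : nat) : topologicalType :=
  swedgeT (fun _ : nat => sphere_pt k).
Definition Hkpt (k : nat) : HkT k := swedge_pt (fun _ : nat => sphere_pt k).

Definition seq_connected (m : nat) (A : topologicalType) (a : A) :=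
  based_classes_trivial H0pt a /\
  (forall k, (1 <= k <= m)%N -> based_classes_trivial (Hkpt k) a).

(* Main.v *)
(* All maps on the cube are extended to the whole space by clamping, and a map
   into the shrinking wedge is a family of maps into the A_j with disjoint
   supports, continuous as soon as every member is. The splitting puts the j-th
   loop into the j-th of a sequence of slabs in the second coordinate.

   For injectivity it suffices to deform any f to the image of some family p
   under the splitting, since then p_j is homotopic to r_j o f. Let f_j = r_j o f
   and U_j = {f_j <> a_j}. Decompose U_j into dyadic cells that shrink towards
   the complement. The restrictions of f_j to the k-cells of this decomposition
   form a null sequence, so if f_j is already trivial on the lower cells and
   k < n, sequential connectedness gives a null sequence of null-homotopies,
   which extend to disjoint diamond-shaped neighbourhoods of the cells inside
   U_j. After finitely many steps f_j is supported in the open n-cells of U_j,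
   and the supports for different j have remained disjoint.

   Now f lives on countably many disjoint boxes, which may be moved linearly as
   long as they stay disjoint: shrink the first side of the k-th box to an
   interval J_k, where the J_k are pairwise disjoint and ordered like the
   midpoints of the original sides; then stretch or move the other sides at will,
   in particular the second ones into pairwise disjoint intervals inside the
   slabs; finally stretch the first sides. *)

Require Import Defs.
From HB Require Import structures.
From mathcomp Require Import finmap.
From mathcomp Require Import all_boot all_order all_algebra.
From mathcomp Require Import all_classical all_reals all_analysis.
From mathcomp Require Import Rstruct Rstruct_topology.
From mathcomp Require Import wedge_sigT.
From mathcomp Require Import ring lra zify.

Set Implicit Arguments.
Unset Strict Implicit.
Unset Printing Implicit Defensive.

Import Order.TTheory GRing.Theory Num.Theory.
Import numFieldNormedType.Exports.
Local Open Scope classical_set_scope.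
Local Open Scope ring_scope.

(** * Continuity and gluing *)

(** The cells of [U_j] accumulate at its boundary, so a homotopy defined cell by cell is continuous
    only if its pieces tend to [a_j]. Vanishing homotopy groups would contract each cell separately,
    without this control. Sequential connectedness contracts a whole null sequence by one homotopy
    on [H0T] or [HkT k], and continuity at the base point of that space supplies the control. Only
    cells of dimension below [n] are contracted, whence the degree [n - 1]; the open [n]-cells carry
    the homotopy class.

    Every deformation of [f_j] keeps the complement of [U_j] at the base point at all times. As the
    [U_j] are disjoint, the homotopies for the various [j] again have disjoint supports and combine
    to a homotopy in the wedge.

    The rearrangement of the boxes is an infinite Eckmann-Hilton argument, and this is where
    [n >= 2] enters: one coordinate keeps the boxes disjoint while another one is changed. All boxes
    move simultaneously. *)

Section Continuity.
Variable X : topologicalType.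

Lemma cont_comp (Y Z : topologicalType) (f : X -> Y) (g : Y -> Z) :
  continuous f -> continuous g -> continuous (fun x => g (f x)).
Proof. by move=> cf cg x; apply: (@continuous_comp _ _ _ f g); [exact: cf|exact: cg]. Qed.

Lemma cont_pair (Y Z : topologicalType) (f : X -> Y) (g : X -> Z) :
  continuous f -> continuous g -> continuous (fun x => (f x, g x)).
Proof. by move=> cf cg x; apply: cvg_pair; [exact: cf|exact: cg]. Qed.

Lemma cont_cst (Y : topologicalType) (y : Y) : continuous (fun _ : X => y).
Proof. by move=> x; exact: cvg_cst. Qed.

Lemma cont_row n (F : X -> 'I_n -> RR) :
  (forall i, continuous (fun x => F x i)) ->
  continuous (fun x => \row_i F x i : 'rV[RR]_n).
Proof.
move=> cF x U [P PF PU].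
have H : \forall y \near x, forall k, P k.1 k.2 (F y k.2).
  apply: filter_forall => -[i j] /=; have := PF i j.
  rewrite mxE => Pij; exact: (cF j x _ Pij).
rewrite nbhs_simpl /=; apply: filterS H => y Hy; apply: PU => i j; rewrite mxE; exact: (Hy (i, j)).
Qed.

Lemma cont_coord n (F : X -> 'rV[RR]_n) i :
  continuous F -> continuous (fun x => F x 0 i).
Proof. by move=> cF; apply: (@cont_comp _ _ F (fun M : 'rV[RR]_n => M 0 i)) => //; exact: coord_continuous. Qed.

Implicit Types f g : X -> RR.

Lemma cont_add f g : continuous f -> continuous g -> continuous (fun x => f x + g x).
Proof. by move=> cf cg x; exact: (@continuousD _ RR^o X f g x (cf x) (cg x)). Qed.

Lemma cont_opp f : continuous f -> continuous (fun x => - f x).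
Proof. by move=> cf x; exact: (@continuousN _ RR^o X f x (cf x)). Qed.

Lemma cont_sub f g : continuous f -> continuous g -> continuous (fun x => f x - g x).
Proof. by move=> cf cg; apply: cont_add => //; exact: cont_opp. Qed.

Lemma cont_mul f g : continuous f -> continuous g -> continuous (fun x => f x * g x).
Proof. by move=> cf cg x; exact: (@continuousM _ X f g x (cf x) (cg x)). Qed.

Lemma cont_min f g : continuous f -> continuous g ->
  continuous (fun x => Num.min (f x) (g x)).
Proof. by move=> cf cg x; exact: (continuous_min (cf x) (cg x)). Qed.

Lemma cont_max f g : continuous f -> continuous g ->
  continuous (fun x => Num.max (f x) (g x)).
Proof. by move=> cf cg x; exact: (continuous_max (cf x) (cg x)). Qed.

Lemma cont_norm n (F : X -> 'rV[RR]_n) :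
  continuous F -> continuous (fun x => `|F x|).
Proof. by move=> cF; apply: (@cont_comp _ _ F (fun M : 'rV[RR]_n => `|M|)) => //; exact: norm_continuous. Qed.

Lemma cont_inv f : (forall x, f x != 0) -> continuous f ->
  continuous (fun x => (f x)^-1).
Proof. by move=> f0 cf x; exact: (@continuousV _ X f x (f0 x) (cf x)). Qed.

Lemma cont_sum n (F : X -> 'I_n -> RR) :
  (forall i, continuous (fun x => F x i)) -> continuous (fun x => \sum_i F x i).
Proof.
move=> cF; elim: (index_enum _) => [|i s IH].
  under eq_fun do rewrite big_nil; exact: cont_cst.
by under eq_fun do rewrite big_cons; exact: cont_add.
Qed.

Lemma cont_within (Y Z : topologicalType) (D : set Y) (f : X -> Y) (g : Y -> Z) :
  continuous f -> (forall x, D (f x)) -> {within D, continuous g} ->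
  continuous (fun x => g (f x)).
Proof.
move=> cf Df /subspace_continuousP cg x U Ugx.
have H : nbhs (f x) [set y | D y -> U (g y)] by exact: (cg _ (Df x) _ Ugx).
have H2 : nbhs x [set y | D (f y) -> U (g (f y))] by exact: (cf x _ H).
by rewrite nbhs_simpl /=; apply: filterS H2 => y; apply.
Qed.

End Continuity.

Lemma within_cont_comp (X Y Z : topologicalType) (D : set X) (f : X -> Y) (g : Y -> Z) :
  {within D, continuous f} -> continuous g -> {within D, continuous (fun x => g (f x))}.
Proof.
move=> /subspace_continuousP cf cg; apply/subspace_continuousP => x Dx.
exact: cvg_comp (cf x Dx) (cg (f x)).
Qed.

Lemma cont_fst (X Y : topologicalType) : continuous (fun p : X * Y => p.1).
Proof. by move=> x; exact: cvg_fst. Qed.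

Lemma cont_snd (X Y : topologicalType) : continuous (fun p : X * Y => p.2).
Proof. by move=> x; exact: cvg_snd. Qed.

Lemma cont_id (X : topologicalType) : continuous (fun x : X => x).
Proof. by move=> x; exact: cvg_id. Qed.

(** * Clamping to the unit cube *)

Definition clamp01 (t : RR) : RR := Num.min 1 (Num.max 0 t).
Definition clampv n (x : 'rV[RR]_n) : 'rV[RR]_n := \row_i clamp01 (x 0 i).
Definition opencube n (x : 'rV[RR]_n) : Prop := forall i, 0 < x 0 i < 1.

Lemma clamp01_itv t : 0 <= clamp01 t <= 1.
Proof. by rewrite /clamp01 le_min ler01 le_max lexx ge_min lexx. Qed.

Lemma clamp01_id t : 0 <= t <= 1 -> clamp01 t = t.
Proof. by move=> /andP[t0 t1]; rewrite /clamp01 max_r // min_r. Qed.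

Lemma clamp01_le0 t : t <= 0 -> clamp01 t = 0.
Proof. by move=> t0; rewrite /clamp01 max_l // min_r // ler01. Qed.

Lemma clamp01_ge1 t : 1 <= t -> clamp01 t = 1.
Proof. by move=> t1; rewrite /clamp01 max_r ?min_l // (le_trans ler01). Qed.

Lemma cont_clamp01 (X : topologicalType) (f : X -> RR) :
  continuous f -> continuous (fun x => clamp01 (f x)).
Proof.
move=> cf; apply: cont_min; first exact: cont_cst.
by apply: cont_max => //; exact: cont_cst.
Qed.

Lemma cont_clampv (X : topologicalType) n (f : X -> 'rV[RR]_n) :
  continuous f -> continuous (fun x => clampv (f x)).
Proof. by move=> cf; apply: cont_row => i; apply: cont_clamp01; exact: cont_coord. Qed.

Lemma clampv_cube n (x : 'rV[RR]_n) : cube n (clampv x).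
Proof. by move=> i; rewrite mxE clamp01_itv. Qed.

Lemma clampv_id n (x : 'rV[RR]_n) : cube n x -> clampv x = x.
Proof. by move=> cx; apply/rowP => i; rewrite mxE clamp01_id. Qed.

Lemma clampv_bdry n (x : 'rV[RR]_n) : ~ opencube x -> cube_bdry n (clampv x).
Proof.
move=> /existsNP[i /negP]; rewrite negb_and -!leNgt => xi.
split; [exact: clampv_cube|exists i; rewrite mxE].
by case/orP: xi => xi; [left; rewrite clamp01_le0|right; rewrite clamp01_ge1].
Qed.

Lemma bdry_opencube n (x : 'rV[RR]_n) : cube_bdry n x -> ~ opencube x.
Proof. by move=> [_ [i [xi|xi]]] /(_ i); rewrite xi ltxx ?andbF. Qed.

Lemma opencube_cube n (x : 'rV[RR]_n) : opencube x -> cube n x.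
Proof. by move=> ox i; have /andP[a b] := ox i; rewrite !ltW. Qed.

Lemma clampv_opencube n (x : 'rV[RR]_n) : opencube (clampv x) -> opencube x.
Proof.
by move=> ox; apply: contrapT => /clampv_bdry/bdry_opencube.
Qed.

(* The union of a family of modifications [H i] of [f] whose supports are
   pairwise disjoint. *)
Section Glue.
Variables (X : topologicalType) (I : choiceType) (A : topologicalType).

Definition glue (f : X -> A) (H : I -> X -> A) (x : X) : A :=
  if pselect (exists i, H i x <> f x) is left e then H (projT1 (cid e)) x
  else f x.

Variables (f : X -> A) (H : I -> X -> A).
Hypothesis disj : forall i j x, H i x <> f x -> H j x <> f x -> i = j.

Lemma glueE i x : H i x <> f x -> glue f H x = H i x.
Proof.
move=> Hi; rewrite /glue; case: pselect => [e|]; last by case; exists i.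
by case: cid => j /= Hj; rewrite (disj Hi Hj).
Qed.

Lemma glue_out x : (forall i, H i x = f x) -> glue f H x = f x.
Proof. by move=> Hx; rewrite /glue; case: pselect => // -[i]; rewrite Hx. Qed.

Lemma glue_cases x : (exists i, H i x <> f x /\ glue f H x = H i x) \/
  ((forall i, H i x = f x) /\ glue f H x = f x).
Proof.
have [[i Hi]|n] := pselect (exists i, H i x <> f x).
  by left; exists i; split => //; exact: glueE.
right; suff Hx : forall i, H i x = f x by split => //; exact: glue_out.
by move=> i; apply: contrapT => Hi; apply: n; exists i.
Qed.

Hypothesis hA : hausdorff_space A.

Lemma open_neq (g h : X -> A) : continuous g -> continuous h ->
  open [set x | g x <> h x].
Proof.
move=> cg ch; rewrite openE => x /= /eqP gh.
have := hA; rewrite open_hausdorff => /(_ _ _ gh)[[P Q] [/=]].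
rewrite !inE => gP hQ [oP oQ /eqP PQ0].
have nP : \forall y \near x, P (g y) by apply: cg; exact: open_nbhs_nbhs.
have nQ : \forall y \near x, Q (h y) by apply: ch; exact: open_nbhs_nbhs.
rewrite /interior; near=> y.
move=> /= ghy; have : (P `&` Q) (g y); last by move/eqP: PQ0 => ->.
by split; [near: y|rewrite ghy; near: y].
Unshelve. all: by end_near. Qed.

Variable a : A.
Hypothesis cf : continuous f.
Hypothesis cH : forall i, continuous (H i).
Hypothesis small : forall N : set A, open N -> N a ->
  finite_set [set i | exists x, H i x <> f x /\ ~ (N (H i x) /\ N (f x))].

(** Where some [H i] differs from [f], it does so on an open set and is the only member that counts
    there. At any other [x] all [H i] agree with [f]; finitely many of them are controlled by
    continuity, the others by [small]. *)
Lemma glue_continuous : continuous (glue f H).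
Proof.
move=> x W; rewrite nbhsE => -[V [oV Vx] VW].
suff : \forall y \near x, V (glue f H y) by apply: filterS => y; exact: VW.
have [[i [Hi gE]]|[Hx gE]] := glue_cases x.
  have n1 : \forall y \near x, H i y <> f y.
    by apply: open_nbhs_nbhs; split=> //; exact: open_neq.
  have n2 : \forall y \near x, V (H i y).
    by apply: cH; apply: open_nbhs_nbhs; split => //; rewrite -gE.
  near=> y; rewrite (@glueE i) //; [near: y; exact: n2|near: y; exact: n1].
(* If [f x = a], the members outside the finite set take values in [V] itself. Otherwise [N] is
   chosen away from [f x], so that these members do not modify [f] near [x] at all. *)
have [N oN [Na NV]] : exists2 N : set A, open N & N a /\
    \forall y \near x, V (f y) /\ (N (f y) -> N `<=` V).
  have cfV : \forall y \near x, V (f y).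
    by apply: cf; apply: open_nbhs_nbhs; split => //; rewrite -gE.
  have [fa|/eqP fa] := pselect (f x = a).
    exists V => //; split; first by rewrite -fa -gE.
    by apply: filterS cfV => y Vy; split => // _ z.
  have := hA; rewrite open_hausdorff => /(_ _ _ fa)[[P Q] [/=]].
  rewrite !inE => gP hQ [oP oQ /eqP PQ0]; exists Q => //; split => //.
  have nP : \forall y \near x, P (f y) by apply: cf; exact: open_nbhs_nbhs.
  near=> y; split; first by near: y.
  move=> Qy; have : (P `&` Q) (f y); last by move/eqP: PQ0 => ->.
  by split => //; near: y.
have Ffin := small oN Na.
set F := (X in finite_set X) in Ffin.
have nF : \forall y \near x, forall i, F i -> V (H i y).
  have /finite_fsetP [F' FE] := Ffin.
  have : \forall y \near x, (\bigcap_(i in [set` F']) [set z | V (H i z)]) y.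
    apply: filter_bigI => i _; apply: cH; apply: open_nbhs_nbhs; split => //.
    by rewrite Hx -gE.
  by apply: filterS => y h i; rewrite FE => /h.
near=> y.
have [[i [Hi ->]]|[_ ->]] := glue_cases y; last first.
  have : V (f y) /\ (N (f y) -> N `<=` V) by near: y.
  by case.
have [Fi|nFi] := pselect (F i); first by move: i Fi {Hi}; near: y.
have [N1 N2] : N (H i y) /\ N (f y).
  by apply: contrapT => h; apply: nFi; exists y.
have [_ sub] : V (f y) /\ (N (f y) -> N `<=` V) by near: y.
exact: sub.
Unshelve. all: by end_near. Qed.

End Glue.

(** * Maps into the shrinking wedge *)

Section Swedge.
Variables (X : nat -> topologicalType) (p0 : forall i, X i).

Local Notation inj i := (@swedge_inj X p0 i).
Local Notation retr := (@swedge_retr X p0).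
Local Notation pt := (swedge_pt p0 : swedgeT p0).

Lemma wedge_prod_inj_at i (x : X i) j : wedge_prod (inj i x) j = @dfwith _ _ p0 i x j.
Proof. by rewrite /swedge_inj /wedge_prod wedge_lift_funE //; exact: wedge_prod_pointE. Qed.

Lemma swedge_injI i : injective (inj i).
Proof.
by move=> x y /(congr1 (fun z => wedge_prod z i)); rewrite !wedge_prod_inj_at !dfwithin.
Qed.

Lemma swedge_inj_neq i j (x : X i) (y : X j) : i != j -> inj i x = inj j y ->
  x = p0 i.
Proof.
move=> ij /(congr1 (fun z => wedge_prod z i)).
by rewrite !wedge_prod_inj_at dfwithin dfwithout // eq_sym.
Qed.

Lemma swedge_inj_pt i : inj i (p0 i) = pt.
Proof. exact: wedge_liftE. Qed.

Lemma swedge_surj (y : swedgeT p0) : exists i x, y = inj i x.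
Proof.
have : [set: wedge p0] y by [].
by rewrite -wedgeTE => -[i _ [x _ <-]]; exists i, x.
Qed.

Lemma swedge_retr_inj i (x : X i) : retr i (inj i x) = x.
Proof.
apply: (@swedge_injI i).
by apply: (@xgetPex _ (p0 i) [set z | inj i z = inj i x]); exists x.
Qed.

Lemma swedge_retr_neq i j (x : X i) : i != j -> retr j (inj i x) = p0 j.
Proof.
move=> ij; rewrite /swedge_retr; case: xgetP => // z _ /= E.
by apply: swedge_inj_neq E; rewrite eq_sym.
Qed.

Lemma swedge_retr_pt j : retr j pt = p0 j.
Proof. by rewrite -(swedge_inj_pt j) swedge_retr_inj. Qed.

Lemma swedge_retr_disj i j y : retr i y <> p0 i -> retr j y <> p0 j -> i = j.
Proof.
have [k [x ->]] := swedge_surj y.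
have [ki _|ki] := eqVneq k i; last by rewrite swedge_retr_neq.
by have [<-|kj] := eqVneq k j; [rewrite -ki|rewrite swedge_retr_neq].
Qed.

(** Inverse of [y |-> (retr j y)_j] on families with at most one nontrivial coordinate; for any
    other family an arbitrary nontrivial coordinate is picked. *)
Definition comb (v : forall j, X j) : swedgeT p0 :=
  if pselect (exists j, v j <> p0 j) is left e then inj _ (v (projT1 (cid e)))
  else pt.

Lemma retr_comb v j : (forall i j, v i <> p0 i -> v j <> p0 j -> i = j) ->
  retr j (comb v) = v j.
Proof.
move=> dv; rewrite /comb; case: pselect => [e|ne].
  case: cid => i /= vi; have [<-|ij] := eqVneq i j; first exact: swedge_retr_inj.
  rewrite swedge_retr_neq //; apply: contrapT => /nesym vj.
  by move: ij; rewrite (dv _ _ vi vj) eqxx.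
rewrite swedge_retr_pt; apply: contrapT => /nesym vj; apply: ne; by exists j.
Qed.

Lemma comb_pt v : (forall j, v j = p0 j) -> comb v = pt.
Proof. by move=> vp; rewrite /comb; case: pselect => // e; exfalso; case: e => j; rewrite vp. Qed.

Lemma comb_retr y : comb (retr^~ y) = y.
Proof.
have [k [x ->]] := swedge_surj y; rewrite /comb; case: pselect => [e|ne].
  case: cid => i /=; have [<- _|ki] := eqVneq k i; first by rewrite swedge_retr_inj.
  by rewrite swedge_retr_neq.
rewrite -(swedge_inj_pt k); congr (inj k _); apply: contrapT => xp; apply: ne.
by exists k; rewrite swedge_retr_inj => /esym.
Qed.

Lemma swedge_openE (U : set (swedgeT p0)) : open U = swedge_open U.
Proof. by []. Qed.

Lemma swedge_retr_continuous j : continuous (retr j).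
Proof.
apply/continuousP => O oO; rewrite swedge_openE; split => [i|].
  have [E|ij] := eqVneq i j.
    subst i; rewrite (_ : _ @^-1` _ = O) //; apply/seteqP.
    by split=> x /=; rewrite swedge_retr_inj.
  have [Op|nOp] := pselect (O (p0 j)).
    rewrite (_ : _ @^-1` _ = setT); first exact: openT.
    by apply/seteqP; split=> x //= _; rewrite swedge_retr_neq.
  rewrite (_ : _ @^-1` _ = set0); first exact: open0.
  by apply/seteqP; split=> x //=; rewrite swedge_retr_neq.
move=> /=; rewrite (swedge_retr_pt j) => Op.
apply: (sub_finite_set _ (finite_set1 j)) => i /= h.
have [//|ij] := eqVneq i j; exfalso; apply: h => _ [x _ <-] /=.
by rewrite swedge_retr_neq.
Qed.

Hypothesis hX : forall i, hausdorff_space (X i).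

(** The shrinking wedge carries the topology induced by the product of the [X j]. An open set
    through the wedge point contains almost all summands, so finitely many coordinates decide. If it
    misses the wedge point, the nontrivial coordinate of [F t] stays nontrivial nearby, by the
    Hausdorff property, and decides alone. *)
Lemma swedge_continuous (T : topologicalType) (F : T -> swedgeT p0) :
  (forall j, continuous (fun t => retr j (F t))) -> continuous F.
Proof.
move=> cF t W; rewrite nbhsE => -[V [oV Vt] VW].
suff : \forall s \near t, V (F s) by apply: filterS => y; exact: VW.
have [op fin] := oV.
have nV j : V (inj j (retr j (F t))) -> \forall s \near t, V (inj j (retr j (F s))).
  move=> Vj; apply: (cF j t (inj j @^-1` V)); apply: open_nbhs_nbhs; split => //; exact: op.
have [Vpt|nVpt] := pselect (V pt).
  have Ffin := fin Vpt.
  have [k [x Ft]] := swedge_surj (F t).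
  have VR j : V (inj j (retr j (F t))).
    have [kj|kj] := eqVneq k j; last by rewrite Ft swedge_retr_neq // swedge_inj_pt.
    by case: _ / kj; rewrite Ft swedge_retr_inj -Ft.
  have /finite_fsetP [F' FE] := Ffin.
  have H : \forall s \near t, (\bigcap_(j in [set` F'])
      [set z | V (inj j (retr j (F z)))]) s.
    by apply: filter_bigI => j _; exact: nV.
  near=> s; have [i [z Fs]] := swedge_surj (F s).
  have [Fi|nFi] := pselect ([set i | ~ range (inj i) `<=` V] i).
    have Hs : (\bigcap_(j in [set` F']) [set z | V (inj j (retr j (F z)))]) s.
      by near: s.
    have := Hs i; rewrite /= Fs swedge_retr_inj; apply.
    by move: Fi; rewrite FE.
  by rewrite Fs; move/contrapT : nFi; apply; exists z.
have [k [x Ft]] := swedge_surj (F t).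
have xp : retr k (F t) <> p0 k.
  by rewrite Ft swedge_retr_inj => xp; apply: nVpt; rewrite -(swedge_inj_pt k) -xp -Ft.
have n1 : \forall s \near t, retr k (F s) <> p0 k.
  have o := @open_neq _ _ (@hX k) _ (fun=> p0 k) (cF k) (@cont_cst _ _ _).
  by apply: (open_nbhs_nbhs (conj o xp)).
have n2 : \forall s \near t, V (inj k (retr k (F s))).
  by apply: nV; rewrite Ft swedge_retr_inj -Ft.
near=> s.
have r1 : retr k (F s) <> p0 k by near: s.
have r2 : V (inj k (retr k (F s))) by near: s.
have [i [z Fs]] := swedge_surj (F s).
have [ik|ik] := eqVneq i k; last by move: r1; rewrite Fs swedge_retr_neq.
by move: r2; rewrite Fs; case: _ / ik; rewrite swedge_retr_inj.
Unshelve. all: by end_near. Qed.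

Lemma comb_continuous (T : topologicalType) (F : forall j, T -> X j) :
  (forall i j t, F i t <> p0 i -> F j t <> p0 j -> i = j) ->
  (forall j, continuous (F j)) -> continuous (fun t => comb (fun j => F j t)).
Proof.
move=> dF cF; apply: swedge_continuous => j.
rewrite (_ : (fun t => _) = F j); first exact: cF.
by apply/funext => t; rewrite retr_comb // => i k; exact: dF.
Qed.

End Swedge.

(** * Homotopies *)

Lemma cont_if (X A : topologicalType) (phi : X -> RR) (c : RR) (K1 K2 : X -> A) :
  continuous phi -> continuous K1 -> continuous K2 ->
  (forall x, phi x = c -> K1 x = K2 x) ->
  continuous (fun x => if phi x <= c then K1 x else K2 x).
Proof.
move=> cphi c1 c2 E x W; rewrite nbhsE => -[V [oV Vx] VW].
suff : \forall y \near x, V (if phi y <= c then K1 y else K2 y).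
  by apply: filterS => y; exact: VW.
have n1 : V (K1 x) -> \forall y \near x, V (K1 y).
  by move=> V1; apply: (c1 x V); apply: open_nbhs_nbhs.
have n2 : V (K2 x) -> \forall y \near x, V (K2 y).
  by move=> V2; apply: (c2 x V); apply: open_nbhs_nbhs.
have [lt|gt|eq] := ltgtP (phi x) c.
- rewrite (ltW lt) in Vx; have n3 : \forall y \near x, phi y < c.
    by apply: (cphi x [set t | t < c]); apply: open_nbhs_nbhs; split => //; exact: open_lt.
  have {}n1 := n1 Vx; near=> y.
  have -> : phi y <= c by apply: ltW; near: y.
  by near: y.
- rewrite leNgt gt /= in Vx; have n3 : \forall y \near x, c < phi y.
    by apply: (cphi x [set t | c < t]); apply: open_nbhs_nbhs; split => //; exact: open_gt.
  have {}n2 := n2 Vx; near=> y.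
  have -> : (phi y <= c) = false by apply/negbTE; rewrite -ltNge; near: y.
  by near: y.
- rewrite eq lexx in Vx; have {}n1 := n1 Vx.
  have {}n2 : \forall y \near x, V (K2 y) by apply: n2; rewrite -E.
  by near=> y; case: ifP => _; near: y.
Unshelve. all: by end_near. Qed.

Section GlobalHomotopy.
Variables (n : nat) (A : topologicalType) (a : A).
Implicit Types (f g : 'rV[RR]_n -> A) (P : set 'rV[RR]_n).

Definition gloop f := continuous f /\ forall x, ~ opencube x -> f x = a.

(** Time ranges over the whole line and space over all rows, so that continuity involves no
    subspace. [P] is the set held at the base point: the complement of the open cube, or of the
    support of a loop. *)
Definition ghom P f g := exists H : RR * 'rV[RR]_n -> A,
  [/\ continuous H, (forall x, H (0, x) = f x), (forall x, H (1, x) = g x) &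
      forall t x, P x -> H (t, x) = a].

Lemma ghom_refl P f : continuous f -> (forall x, P x -> f x = a) -> ghom P f f.
Proof.
move=> cf fP; exists (fun p => f p.2); split => //.
by apply: cont_comp cf; exact: cont_snd.
Qed.

Lemma ghom_sym P f g : ghom P f g -> ghom P g f.
Proof.
move=> [H [cH H0 H1 HP]]; exists (fun p => H (1 - p.1, p.2)); split => [|x|x|t x Px].
- apply: cont_comp cH; apply: cont_pair; last exact: cont_snd.
  by apply: cont_sub; [exact: cont_cst|exact: cont_fst].
- by rewrite /= subr0.
- by rewrite /= subrr.
- exact: HP.
Qed.

Lemma ghom_trans P f g h : ghom P f g -> ghom P g h -> ghom P f h.
Proof.
move=> [H [cH H0 H1 HP]] [K [cK K0 K1 KP]].
exists (fun p => if p.1 <= 2^-1 then H (clamp01 (2 * p.1), p.2)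
                 else K (clamp01 (2 * p.1 - 1), p.2)); split => [|x|x|t x Px].
- apply: cont_if; first exact: cont_fst.
  + apply: cont_comp cH; apply: cont_pair; last exact: cont_snd.
    apply: cont_clamp01; apply: cont_mul; [exact: cont_cst|exact: cont_fst].
  + apply: cont_comp cK; apply: cont_pair; last exact: cont_snd.
    apply: cont_clamp01; apply: cont_sub; last exact: cont_cst.
    by apply: cont_mul; [exact: cont_cst|exact: cont_fst].
  + move=> [t x] /= ->; rewrite divff // subrr clamp01_ge1 // H1.
    by rewrite clamp01_le0.
- by rewrite /= mulr0 clamp01_le0 // invr_ge0 ler0n.
- rewrite /= [X in if X then _ else _](_ : _ = false); last by apply/negbTE; lra.
  by rewrite clamp01_ge1 //; lra.
- by case: ifP => _; [exact: HP|exact: KP].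
Qed.

Definition outcube := [set x : 'rV[RR]_n | ~ opencube x].

Lemma nloop_gloop f : nloop a f -> gloop (fun x => f (clampv x)).
Proof.
move=> [cf fb]; split => [|x /clampv_bdry]; last exact: fb.
apply: cont_within cf => [|x]; last exact: clampv_cube.
by apply: cont_clampv; exact: cont_id.
Qed.

Lemma gloop_nloop f : gloop f -> nloop a f.
Proof.
move=> [cf fb]; split; first exact: continuous_subspaceT.
by move=> x /bdry_opencube; exact: fb.
Qed.

Lemma ghom_nhomotopic f g f' g' : (forall x, cube n x -> f x = f' x) ->
  (forall x, cube n x -> g x = g' x) -> ghom outcube f' g' -> nhomotopic a f g.
Proof.
move=> ff gg [H [cH H0 H1 HP]]; exists H; split.
- exact: continuous_subspaceT.
- by move=> x cx; rewrite H0 H1 ff ?gg.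
- by move=> t x _ /bdry_opencube; exact: HP.
Qed.

Lemma nhomotopic_ghom f g : nhomotopic a f g ->
  ghom outcube (fun x => f (clampv x)) (fun x => g (clampv x)).
Proof.
move=> [H [cH H01 HP]]; exists (fun p => H (clamp01 p.1, clampv p.2)).
split => [|x|x|t x ox].
- apply: cont_within cH => [|p].
    by apply: cont_pair; [apply: cont_clamp01; exact: cont_fst|apply: cont_clampv; exact: cont_snd].
  by split => /=; [exact: clamp01_itv|exact: clampv_cube].
- by rewrite /= clamp01_le0 //; have [] := H01 _ (clampv_cube x).
- by rewrite /= clamp01_ge1 //; have [] := H01 _ (clampv_cube x).
- by apply: HP; [exact: clamp01_itv|exact: clampv_bdry].
Qed.

Lemma nhomotopicP f g : nhomotopic a f g <->
  ghom outcube (fun x => f (clampv x)) (fun x => g (clampv x)).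
Proof.
split; first exact: nhomotopic_ghom.
by apply: ghom_nhomotopic => x /clampv_id ->.
Qed.

Lemma nhomotopic_sym f g : nhomotopic a f g -> nhomotopic a g f.
Proof. by move=> /nhomotopicP/ghom_sym/nhomotopicP. Qed.

Lemma nhomotopic_trans g f h :
  nhomotopic a f g -> nhomotopic a g h -> nhomotopic a f h.
Proof.
move=> /nhomotopicP fg /nhomotopicP gh; apply/nhomotopicP; exact: ghom_trans fg gh.
Qed.

Lemma nhomotopic_eq f g : nloop a f -> (forall x, cube n x -> f x = g x) ->
  nhomotopic a f g.
Proof.
move=> /nloop_gloop[cf fb] fg; apply: ghom_nhomotopic; last first.
- by apply: (@ghom_refl outcube (fun x => f (clampv x))) => // x; exact: fb.
- by move=> x cx /=; rewrite clampv_id // ?fg.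
- by move=> x cx /=; rewrite clampv_id // ?fg.
Qed.

End GlobalHomotopy.

(** * Moving boxes *)

Section Boxes.
Variable n : nat.
Implicit Types l r x : 'rV[RR]_n.

(** Affine coordinates in which the box becomes the unit cube. *)
Definition ubox l r x : 'rV[RR]_n := \row_i ((x 0 i - l 0 i) / (r 0 i - l 0 i)).
Definition box l r := forall i, l 0 i < r 0 i.
Definition inunit l r := forall i, 0 <= l 0 i /\ r 0 i <= 1.

Lemma ubox_opencube l r x : box l r ->
  opencube (ubox l r x) <-> forall i, l 0 i < x 0 i < r 0 i.
Proof.
move=> lr; split => h i; have := h i; rewrite mxE; have lri := lr i.
  by rewrite ltr_pdivlMr ?subr_gt0 // mul0r ltr_pdivrMr ?subr_gt0 // mul1r; lra.
by move=> /andP[h1 h2]; rewrite ltr_pdivlMr ?subr_gt0 // mul0r ltr_pdivrMr ?subr_gt0 // mul1r; lra.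
Qed.

Lemma ubox_out l r x : box l r -> inunit l r -> ~ opencube x ->
  ~ opencube (ubox l r x).
Proof.
move=> lr u ox /(ubox_opencube _ lr) h; apply: ox => i.
by have := h i; have := u i; lra.
Qed.

Lemma ubox_disj l r l' r' x : box l r -> box l' r' ->
  (exists d, r 0 d <= l' 0 d \/ r' 0 d <= l 0 d) ->
  opencube (ubox l r x) -> opencube (ubox l' r' x) -> False.
Proof.
move=> lr lr' [d hd] /(ubox_opencube _ lr) h /(ubox_opencube _ lr') h'.
by have := h d; have := h' d; case: hd => hd; lra.
Qed.

Lemma ubox_continuous (X : topologicalType) (l r x : X -> 'rV[RR]_n) :
  (forall p, box (l p) (r p)) -> continuous l -> continuous r -> continuous x ->
  continuous (fun p => ubox (l p) (r p) (x p)).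
Proof.
move=> lr cl cr cx; apply: cont_row => i; apply: cont_mul.
  by apply: cont_sub; exact: cont_coord.
apply: cont_inv; last by apply: cont_sub; exact: cont_coord.
by move=> p; rewrite subr_eq0 gt_eqF // lr.
Qed.

(** The time is clamped so that interpolated boxes remain boxes for every real [t]. *)
Definition interp (u v : 'rV[RR]_n) (t : RR) : 'rV[RR]_n :=
  \row_i ((1 - clamp01 t) * u 0 i + clamp01 t * v 0 i).

Lemma interp0 u v : interp u v 0 = u.
Proof. by apply/rowP => i; rewrite mxE clamp01_id ?lexx ?ler01 // subr0 mul1r mul0r addr0. Qed.

Lemma interp1 u v : interp u v 1 = v.
Proof. by apply/rowP => i; rewrite mxE clamp01_id ?lexx ?ler01 // subrr mul1r mul0r add0r. Qed.

Lemma cont_interp (X : topologicalType) u v (f : X -> RR) : continuous f ->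
  continuous (fun p => interp u v (f p)).
Proof.
move=> cf; apply: cont_row => i; apply: cont_add; apply: cont_mul; try exact: cont_cst.
  by apply: cont_sub; [exact: cont_cst|exact: cont_clamp01].
exact: cont_clamp01.
Qed.

Lemma interp_le (u v u' v' : 'rV[RR]_n) t d : u 0 d <= u' 0 d -> v 0 d <= v' 0 d ->
  interp u v t 0 d <= interp u' v' t 0 d.
Proof.
move=> hu hv; rewrite !mxE; have /andP[c0 c1] := clamp01_itv t.
by apply: lerD; apply: ler_wpM2l => //; rewrite subr_ge0.
Qed.

Lemma interp_lt (u v u' v' : 'rV[RR]_n) t d : u 0 d < u' 0 d -> v 0 d < v' 0 d ->
  interp u v t 0 d < interp u' v' t 0 d.
Proof.
move=> hu hv; rewrite !mxE; have /andP[c0 c1] := clamp01_itv t.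
have [->|cn] := eqVneq (clamp01 t) 0; first by rewrite subr0 !mul1r !mul0r !addr0.
apply: ler_ltD; first by apply: ler_wpM2l; rewrite ?subr_ge0 // ltW.
by rewrite ltr_pM2l // lt_def cn.
Qed.

Lemma interp_box l r l' r' t : box l r -> box l' r' ->
  box (interp l l' t) (interp r r' t).
Proof. by move=> h h' i; exact: interp_lt. Qed.

Lemma interp_inunit l r l' r' t : inunit l r -> inunit l' r' ->
  inunit (interp l l' t) (interp r r' t).
Proof.
move=> h h' i; have [h1 h2] := h i; have [h3 h4] := h' i; rewrite !mxE.
have /andP[c0 c1] := clamp01_itv t; move: (clamp01 t) c0 c1 => c c0 c1.
have d0 : 0 <= 1 - c by rewrite subr_ge0.
by split; [apply: addr_ge0; exact: mulr_ge0|nra].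
Qed.

End Boxes.

Section BoxFamily.
Variables (n : nat) (A : nat -> topologicalType) (a : forall j, A j).
Hypothesis hA : forall j, hausdorff_space (A j).
Variables (I : choiceType) (valid : nat -> I -> Prop).

Definition spread (q : forall j, I -> 'rV[RR]_n -> A j)
    (l r : nat -> I -> 'rV[RR]_n) j (x : 'rV[RR]_n) : A j :=
  glue (fun=> a j) (fun i x => q j i (ubox (l j i) (r j i) x)) x.

Definition apart (l r : nat -> I -> 'rV[RR]_n) :=
  forall j i j' i', valid j i -> valid j' i' -> (j, i) <> (j', i') ->
    exists d, r j i 0 d <= l j' i' 0 d \/ r j' i' 0 d <= l j i 0 d.

(** Only valid indices will carry nonconstant maps, so only their boxes must lie in the cube. [box]
    is imposed on all indices, so that [ubox] never divides by zero. *)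
Definition boxes (l r : nat -> I -> 'rV[RR]_n) :=
  (forall j i, box (l j i) (r j i)) /\
  (forall j i, valid j i -> inunit (l j i) (r j i)).

Variable q : forall j, I -> 'rV[RR]_n -> A j.
Hypothesis qc : forall j i, continuous (q j i).
Hypothesis qa : forall j i x, ~ opencube x -> q j i x = a j.
Hypothesis qv : forall j i x, ~ valid j i -> q j i x = a j.
Hypothesis qs : forall j (N : set (A j)), open N -> N (a j) ->
  finite_set [set i | exists x, ~ N (q j i x)].

Lemma q_neq j i x : q j i x <> a j -> valid j i /\ opencube x.
Proof.
move=> h; split; apply: contrapT => h'; apply: h; [exact: qv|exact: qa].
Qed.

Lemma spread_neq l r j x : spread q l r j x <> a j ->
  exists2 i, valid j i & opencube (ubox (l j i) (r j i) x).
Proof.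
move=> h; have [i] : exists i, q j i (ubox (l j i) (r j i) x) <> a j.
  apply: contrapT => ne; apply: h; rewrite /spread /glue.
  by case: pselect => // e; exfalso; exact: ne.
by move=> /q_neq[? ?]; exists i.
Qed.

Lemma apart_disj l r x j i j' i' : boxes l r -> apart l r ->
  valid j i -> valid j' i' -> opencube (ubox (l j i) (r j i) x) ->
  opencube (ubox (l j' i') (r j' i') x) -> (j, i) = (j', i').
Proof.
move=> [lr _] ap vi vi' o o'; apply: contrapT => ne.
exact: (ubox_disj (lr _ _) (lr _ _) (ap _ _ _ _ vi vi' ne) o o').
Qed.

Lemma spread_disj l r i j x : boxes l r -> apart l r ->
  spread q l r i x <> a i -> spread q l r j x <> a j -> i = j.
Proof.
move=> b ap /spread_neq[k vk ok] /spread_neq[k' vk' ok'].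
by have [] := apart_disj b ap vk vk' ok ok'.
Qed.

Lemma spreadE l r j i x : boxes l r -> apart l r -> valid j i ->
  opencube (ubox (l j i) (r j i) x) ->
  spread q l r j x = q j i (ubox (l j i) (r j i) x).
Proof.
move=> b ap vi oi.
have [E|ne] := pselect (q j i (ubox (l j i) (r j i) x) = a j); last first.
  rewrite /spread; apply: (glueE (H := fun i x => q j i (ubox (l j i) (r j i) x))) => //.
  move=> k k' y /q_neq[vk ok] /q_neq[vk' ok'].
  by have [] := apart_disj b ap vk vk' ok ok'.
rewrite E; apply: contrapT => h.
have [k kne] : exists k, q j k (ubox (l j k) (r j k) x) <> a j.
  apply: contrapT => ne; apply: h; rewrite /spread /glue.
  by case: pselect => // e; exfalso; exact: ne.
have [vk ok] := q_neq kne.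
by have [E'] := apart_disj b ap vi vk oi ok; apply: kne; rewrite -E' E.
Qed.

(** Each box moves continuously; for infinitely many boxes, joint continuity comes from the values
    alone, since whether [q j i] stays in a neighbourhood of [a j] does not depend on the position
    of its box. *)
Lemma spread_move (l r : RR -> nat -> I -> 'rV[RR]_n) :
  (forall t, boxes (l t) (r t)) -> (forall t, apart (l t) (r t)) ->
  (forall j i, continuous (fun t => l t j i)) ->
  (forall j i, continuous (fun t => r t j i)) ->
  forall j, continuous (fun p : RR * 'rV[RR]_n => spread q (l p.1) (r p.1) j p.2).
Proof.
move=> b ap cl cr j.
apply: (@glue_continuous (RR * 'rV[RR]_n)%type I (A j) (fun=> a j)
  (fun i p => q j i (ubox (l p.1 j i) (r p.1 j i) p.2)) _ _ (a j)).
- move=> i i' p /q_neq[vi oi] /q_neq[vi' oi'].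
  by have [] := apart_disj (b _) (ap _) vi vi' oi oi'.
- exact: hA.
- exact: cont_cst.
- move=> i; apply: cont_comp; last exact: qc.
  apply: ubox_continuous => [p|||]; first by have [] := b p.1.
  + by apply: (@cont_comp _ _ _ fst (fun t => l t j i)) => //; exact: cont_fst.
  + by apply: (@cont_comp _ _ _ fst (fun t => r t j i)) => //; exact: cont_fst.
  + exact: cont_snd.
- move=> N oN Na; apply: sub_finite_set (qs oN Na) => i /= [p [_ h]].
  by exists (ubox (l p.1 j i) (r p.1 j i) p.2) => Nq; apply: h.
Qed.

Lemma spread_out l r j x : boxes l r -> ~ opencube x -> spread q l r j x = a j.
Proof.
move=> [b1 b2] ox; apply: contrapT => /spread_neq[i vi].
by apply: ubox_out => //; exact: b2.
Qed.

(* Linear interpolation keeps two boxes separated in coordinate [d] as soon as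
   they are separated in the same way at both ends. *)
Lemma spread_isotopy l r l' r' : boxes l r -> boxes l' r' ->
  (forall j i j' i', valid j i -> valid j' i' -> (j, i) <> (j', i') ->
     exists d, (r j i 0 d <= l j' i' 0 d /\ r' j i 0 d <= l' j' i' 0 d) \/
               (r j' i' 0 d <= l j i 0 d /\ r' j' i' 0 d <= l' j i 0 d)) ->
  ghom (swedge_pt a : swedgeT a) (@outcube n)
    (fun x => comb a (fun j => spread q l r j x))
    (fun x => comb a (fun j => spread q l' r' j x)).
Proof.
move=> [b u] [b' u'] ap.
pose L t j i := interp (l j i) (l' j i) t; pose R t j i := interp (r j i) (r' j i) t.
have bLR t : boxes (L t) (R t).
  split => [j i|j i vi]; first exact: interp_box.
  by apply: interp_inunit; [exact: u|exact: u'].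
have apLR t : apart (L t) (R t).
  move=> j i j' i' v v' ne; have [d hd] := ap _ _ _ _ v v' ne; exists d.
  by case: hd => -[h1 h2]; [left|right]; exact: interp_le.
exists (fun p => comb a (fun j => spread q (L p.1) (R p.1) j p.2)); split.
- apply: (comb_continuous hA (F := fun j p => spread q (L p.1) (R p.1) j p.2)).
    by move=> i j p; exact: spread_disj.
  move=> j; apply: (spread_move bLR apLR) => k i.
    by apply: (@cont_interp _ _ (l k i) (l' k i) id); exact: cont_id.
  by apply: (@cont_interp _ _ (r k i) (r' k i) id); exact: cont_id.
- move=> x; congr comb; apply: functional_extensionality_dep => j /=.
  by congr (spread q _ _ j x); apply/funext => k; apply/funext => i; exact: interp0.
- move=> x; congr comb; apply: functional_extensionality_dep => j /=.
  by congr (spread q _ _ j x); apply/funext => k; apply/funext => i; exact: interp1.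
- by move=> t x ox /=; apply: comb_pt => j; apply: spread_out.
Qed.

End BoxFamily.

(** * The splitting *)

Lemma coord0E n (i0 : 'I_n) (x : 'rV[RR]_n) : val i0 = 0%N -> Defs.coord0 x = x 0 i0.
Proof. by move=> i00; rewrite /Defs.coord0 (big_pred1 i0) // => i /=; rewrite -i00. Qed.

Definition left_half n (x : 'rV[RR]_n) : 'rV[RR]_n :=
  \row_i (if val i == 0%N then 2 * x 0 i else x 0 i).
Definition right_half n (x : 'rV[RR]_n) : 'rV[RR]_n :=
  \row_i (if val i == 0%N then 2 * x 0 i - 1 else x 0 i).

Lemma nconcatE n (A : Type) (f g : 'rV[RR]_n -> A) x :
  nconcat f g x = if Defs.coord0 x <= 2^-1 then f (left_half x) else g (right_half x).
Proof. by []. Qed.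

Lemma nconcat_gloop n (A : topologicalType) (a : A) (f g : 'rV[RR]_n -> A) :
  (0 < n)%N -> gloop a f -> gloop a g -> gloop a (nconcat f g).
Proof.
move=> n0 [cf fa] [cg ga]; pose i0 := Ordinal n0.
have c0 x : Defs.coord0 x = x 0 i0 by exact: coord0E.
have ccoord : continuous (@Defs.coord0 n).
  have -> : @Defs.coord0 n = fun x => x 0 i0 by exact/funext.
  by apply: cont_coord; exact: cont_id.
split.
  have E : nconcat f g = fun x => if Defs.coord0 x <= 2^-1 then f (left_half x) else g (right_half x) by [].
  rewrite E; apply: cont_if.
  - exact: ccoord.
  - apply: cont_comp cf; apply: cont_row => i; case: (val i == 0%N).
      by apply: cont_mul; [exact: cont_cst|apply: cont_coord; exact: cont_id].
    by apply: cont_coord; exact: cont_id.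
  - apply: cont_comp cg; apply: cont_row => i; case: (val i == 0%N).
      apply: cont_sub; last exact: cont_cst.
      by apply: cont_mul; [exact: cont_cst|apply: cont_coord; exact: cont_id].
    by apply: cont_coord; exact: cont_id.
  - move=> x; rewrite c0 => xE; rewrite fa ?ga // => /(_ i0); rewrite mxE /= xE; lra.
move=> x /existsNP[i /negP]; rewrite nconcatE c0 negb_and -!leNgt => xi.
have [ii0|ii0] := eqVneq (val i) 0%N.
  have {ii0} ii0 : i = i0 by exact: val_inj.
  rewrite ii0 in xi; case/orP: xi => xi.
    rewrite (_ : _ <= _); last by lra.
    by rewrite fa // => /(_ i0); rewrite mxE /=; lra.
  rewrite (_ : _ <= _ = false); last by apply/negbTE; lra.
  by rewrite ga // => /(_ i0); rewrite mxE /=; lra.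
by case: ifP => _; [rewrite fa //|rewrite ga //] => /(_ i);
  rewrite mxE (negbTE ii0) => /andP[h1 h2]; case/orP: xi; rewrite leNgt ?h1 ?h2.
Qed.

Lemma half_cube n (x : 'rV[RR]_n) : (0 < n)%N -> cube n x ->
  if Defs.coord0 x <= 2^-1 then cube n (left_half x) else cube n (right_half x).
Proof.
move=> n0 cx; rewrite (coord0E (i0 := Ordinal n0)) //.
case: ifPn => hx i; have /andP[h1 h2] := cx i; rewrite mxE; case: eqP => [i0|_];
  rewrite ?h1 ?h2 //; move: h1 h2; rewrite (_ : i = Ordinal n0); try exact: val_inj.
  by move=> h1 h2; apply/andP; split; lra.
by move: hx; rewrite -ltNge => hx h1 h2; apply/andP; split; lra.
Qed.

Lemma nconcat_nloop n (A : topologicalType) (a : A) (f g : 'rV[RR]_n -> A) :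
  (0 < n)%N -> nloop a f -> nloop a g -> nloop a (nconcat f g).
Proof.
move=> n0 /nloop_gloop lf /nloop_gloop lg.
have [c b] := gloop_nloop (nconcat_gloop n0 lf lg).
have E x : cube n x -> nconcat f g x =
    nconcat (fun x => f (clampv x)) (fun x => g (clampv x)) x.
  move=> cx; rewrite !nconcatE; have := half_cube n0 cx.
  by case: ifP => _ ch; rewrite clampv_id.
split; last by move=> x [cx bx]; rewrite E //; apply: b.
apply: subspace_eq_continuous c => x /set_mem cx; exact/esym/E.
Qed.

Section Sect.
Variables (n : nat) (hn : (2 <= n)%N).
Variables (A : nat -> topologicalType) (a : forall j, A j).
Hypothesis hA : forall j, hausdorff_space (A j).
Local Notation pt := (swedge_pt a : swedgeT a).
Local Notation retr := (@swedge_retr A a).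

Definition slabl j : 'rV[RR]_n := \row_i (if val i == 1%N then 1 - 2^-1 ^+ j else 0).
Definition slabr j : 'rV[RR]_n := \row_i (if val i == 1%N then 1 - 2^-1 ^+ j.+1 else 1).

(* The [j]-th loop is placed in the slab [1 - 2^-j, 1 - 2^-(j+1)] of the second
   coordinate, so that the construction commutes with concatenation, which only
   involves the first one. *)
Definition sect (f : forall j, 'rV[RR]_n -> A j) (x : 'rV[RR]_n) : swedgeT a :=
  comb a (fun j => f j (clampv (ubox (slabl j) (slabr j) x))).

Lemma half_gt0 j : 0 < 2^-1 ^+ j :> RR.
Proof. by rewrite exprn_gt0 // invr_gt0 ltr0n. Qed.

Lemma half_le1 j : 2^-1 ^+ j <= 1 :> RR.
Proof. by rewrite exprn_ile1 //; lra. Qed.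

Lemma slab_box j : box (slabl j) (slabr j).
Proof.
move=> i; rewrite !mxE; case: ifP => _; last exact: ltr01.
by have := half_gt0 j; rewrite exprS; lra.
Qed.

Lemma slab_inunit j : inunit (slabl j) (slabr j).
Proof.
move=> i; rewrite !mxE; case: ifP => _; last by rewrite !lexx.
by have := half_gt0 j.+1; have := half_le1 j; split; lra.
Qed.

Lemma slab_le j j' i : val i == 1%N -> (j < j')%N -> slabr j 0 i <= slabl j' 0 i.
Proof.
move=> i1 jj; rewrite !mxE i1 lerD2l lerN2.
by apply: ler_wiXn2l => //; lra.
Qed.

Lemma slab_apart j j' : j <> j' ->
  exists d, slabr j 0 d <= slabl j' 0 d \/ slabr j' 0 d <= slabl j 0 d.
Proof.
move=> jj; exists (Ordinal hn).
by have [h|h|//] := ltngtP j j'; [left|right]; exact: slab_le.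
Qed.

Lemma sect_continuous (H : forall j, RR * 'rV[RR]_n -> A j) :
  (forall j, continuous (H j)) ->
  (forall j t x, ~ opencube x -> H j (t, x) = a j) ->
  continuous (fun p => comb a (fun j => H j (p.1, ubox (slabl j) (slabr j) p.2))).
Proof.
move=> cH Ha.
have neq j t x : H j (t, x) <> a j -> opencube x.
  by move=> h; apply: contrapT => /(Ha j t).
apply: (comb_continuous hA
  (F := fun j p => H j (p.1, ubox (slabl j) (slabr j) p.2))).
  move=> i j p /neq oi /neq oj; apply: contrapT => ij.
  exact: (ubox_disj (@slab_box i) (@slab_box j) (slab_apart ij) oi oj).
move=> j; apply: cont_comp (cH j); apply: cont_pair; first exact: cont_fst.
apply: ubox_continuous => [p|||]; [exact: slab_box|exact: cont_cst|exact: cont_cst|exact: cont_snd].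
Qed.

Lemma sect_ghom f g : (forall j, nloop (a j) (f j)) ->
  (forall j, nhomotopic (a j) (f j) (g j)) -> ghom pt (@outcube n) (sect f) (sect g).
Proof.
move=> lf hfg.
pose E j := cid (nhomotopic_ghom (hfg j)); pose H j := projT1 (E j).
have hH j : [/\ continuous (H j), (forall x, H j (0, x) = f j (clampv x)),
    (forall x, H j (1, x) = g j (clampv x)) &
    forall t x, outcube x -> H j (t, x) = a j] := projT2 (E j).
exists (fun p => comb a (fun j => H j (p.1, ubox (slabl j) (slabr j) p.2))).
split.
- apply: sect_continuous => j; first by have [] := hH j.
  by move=> t x; have [_ _ _] := hH j; apply.
- move=> x; congr comb; apply: functional_extensionality_dep => j.
  by have [_ -> _ _] := hH j.
- move=> x; congr comb; apply: functional_extensionality_dep => j.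
  by have [_ _ -> _] := hH j.
- move=> t x ox; apply: comb_pt => j; have [_ _ _] := hH j; apply => /=.
  exact: (ubox_out (@slab_box j) (@slab_inunit j) ox).
Qed.

Lemma nhomotopic_refl (B : topologicalType) (b : B) (f : 'rV[RR]_n -> B) :
  nloop b f -> nhomotopic b f f.
Proof. by move=> lf; exact: nhomotopic_eq. Qed.

Lemma sect_gloop f : (forall j, nloop (a j) (f j)) -> gloop pt (sect f).
Proof.
(* Continuity of [sect f] is read off from a homotopy of [sect f] to itself. *)
move=> lf; have [H [cH H0 _ Ha]] : ghom pt (@outcube n) (sect f) (sect f).
  by apply: sect_ghom => // j; exact: nhomotopic_refl.
split; last by move=> x ox; rewrite -H0 Ha.
rewrite (_ : sect f = fun x => H (0, x)); last exact/funext.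
by apply: cont_comp cH; apply: cont_pair; [exact: cont_cst|exact: cont_id].
Qed.

Lemma sect_nconcat f g x : (forall j, nloop (a j) (f j)) ->
  (forall j, nloop (a j) (g j)) -> cube n x ->
  sect (fun j => nconcat (f j) (g j)) x = nconcat (sect f) (sect g) x.
Proof.
move=> lf lg cx; have n0 : (0 < n)%N by exact: leq_trans hn.
pose i0 := Ordinal n0.
have c0 y : Defs.coord0 y = y 0 i0 by exact: coord0E.
have cE j : Defs.coord0 (clampv (ubox (slabl j) (slabr j) x)) = Defs.coord0 x.
  by rewrite !c0 !mxE /= subr0 subr0 divr1 clamp01_id.
pose u j y := clampv (ubox (slabl j) (slabr j) y).
rewrite nconcatE /sect (_ : comb a _ = comb a (fun j =>
  if Defs.coord0 x <= 2^-1 then f j (left_half (u j x)) else g j (right_half (u j x)))).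
  have := half_cube n0 cx.
  case: ifPn => _ ch; congr comb; apply: functional_extensionality_dep => j;
    congr (_ _); apply/rowP => i; have := ch i; have := cx i; rewrite !mxE;
    case: eqP => //= i00; rewrite i00 /= !subr0 !divr1 => hx hx';
    by rewrite !clamp01_id.
by congr comb; apply: functional_extensionality_dep => j; rewrite nconcatE cE.
Qed.

Lemma retr_sect f j : (forall j, nloop (a j) (f j)) ->
  (fun x => retr j (sect f x)) = (fun x => f j (clampv (ubox (slabl j) (slabr j) x))).
Proof.
move=> lf; apply/funext => x; rewrite retr_comb // => i k.
have neq l y : f l (clampv y) <> a l -> opencube y.
  move=> h; apply: contrapT => /clampv_bdry b; apply: h.
  by have [_] := lf l; apply.
move=> /neq oi /neq oj; apply: contrapT => ij.
exact: (ubox_disj (@slab_box i) (@slab_box k) (slab_apart ij) oi oj).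
Qed.

(** Enlarging the [j]-th slab linearly to the whole cube turns the rescaled loop back into [f j]. *)
Lemma retr_sect_homotopic f j : (forall j, nloop (a j) (f j)) ->
  nhomotopic (a j) (retr j \o sect f) (f j).
Proof.
move=> lf; rewrite (_ : _ \o _ = fun x => retr j (sect f x)) // retr_sect //.
have [cf fa] := nloop_gloop (lf j).
pose L t := interp (slabl j) 0 t; pose R t := interp (slabr j) (const_mx 1) t.
have b01 : box (0 : 'rV[RR]_n) (const_mx 1) by move=> i; rewrite !mxE ltr01.
have u01 : inunit (0 : 'rV[RR]_n) (const_mx 1) by move=> i; rewrite !mxE !lexx.
have bLR t : box (L t) (R t) by apply: interp_box => //; exact: slab_box.
have uLR t : inunit (L t) (R t) by apply: interp_inunit => //; exact: slab_inunit.
apply: (ghom_nhomotopic (f' := fun x => f j (clampv (ubox (slabl j) (slabr j) x)))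
                        (g' := fun x => f j (clampv x))) => [x //|x cx|].
  by rewrite clampv_id.
exists (fun p => f j (clampv (ubox (L p.1) (R p.1) p.2))); split.
- apply: cont_comp cf; apply: ubox_continuous => [p|||]; first exact: bLR.
  + by apply: cont_interp; exact: cont_fst.
  + by apply: cont_interp; exact: cont_fst.
  + exact: cont_snd.
- by move=> x; rewrite /L /R !interp0.
- move=> x; rewrite /L /R !interp1; congr (f j (clampv _)).
  by apply/rowP => i; rewrite !mxE !subr0 divr1.
- by move=> t x ox; apply: fa; exact: ubox_out.
Qed.

End Sect.

(** * Dyadic decomposition of an open set *)

Lemma intr_ltS (C z : int) : C%:~R < z%:~R + 1 :> RR -> C%:~R <= z%:~R :> RR.
Proof. by rewrite -[1]/(1%:~R) -intrD ltr_int ler_int ltzD1. Qed.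

Lemma intr_gtS (C z : int) : z%:~R < C%:~R :> RR -> z%:~R + 1 <= C%:~R :> RR.
Proof. by rewrite -[1]/(1%:~R) -intrD ltr_int ler_int lezD1. Qed.

Lemma norm_coord n (x : 'rV[RR]_n) i : `|x 0 i| <= `|x|.
Proof.
by rewrite [leRHS]/Num.Def.normr /= mx_normrE; apply/bigmax_geP; right => /=; exists (0, i).
Qed.

Lemma norm_le n (x : 'rV[RR]_n) (c : RR) :
  0 <= c -> (forall i, `|x 0 i| <= c) -> `|x| <= c.
Proof.
move=> c0 h; rewrite [leLHS]/Num.Def.normr /= mx_normrE; apply/bigmax_leP; split => //.
by move=> [i j] _ /=; rewrite ord1.
Qed.

Lemma norm_lt n (x : 'rV[RR]_n) (c : RR) :
  0 < c -> (forall i, `|x 0 i| < c) -> `|x| < c.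
Proof.
move=> c0 h; rewrite [ltLHS]/Num.Def.normr /= mx_normrE; apply/bigmax_ltP; split => //.
by move=> [i j] _ /=; rewrite ord1.
Qed.

Section Grid.
Variables (n : nat) (U : set 'rV[RR]_n).
Implicit Types (x y : 'rV[RR]_n) (m : nat) (z : {ffun 'I_n -> int}) (D : {set 'I_n}).

(** Coordinates in units of the mesh [2^-m]: the grid hyperplanes become the integers. *)
Definition sc m x i : RR := x 0 i * 2 ^+ m.

Definition good m z := forall y,
  (forall i, (z i)%:~R <= sc m y i <= (z i)%:~R + 1) -> U y.

(** Quantifying over all closed cubes that contain [x] lets the condition pass from a cell to every
    cell that has it as a face. *)
Definition onlevel m x := forall z,
  (forall i, (z i)%:~R <= sc m x i <= (z i)%:~R + 1) -> good m z.

(* The points of level [m] form a union of open cells of the grid of mesh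
   [2^-m]; over all [m] these cells decompose [U] as in Whitney's lemma. *)
Definition level m x := onlevel m x /\ forall m', (m' < m)%N -> ~ onlevel m' x.

(* It follows that every closed dyadic cell of level [m] that contains [y]
   contains [x]. *)
Definition adherent m x y := forall i (C : int),
  (C%:~R <= sc m y i -> C%:~R <= sc m x i) /\
  (sc m y i <= C%:~R -> sc m x i <= C%:~R).

Definition ongrid m x i := exists C : int, sc m x i = C%:~R.

Lemma sc_gt0 m : 0 < 2 ^+ m :> RR. Proof. by rewrite exprn_gt0. Qed.

Lemma scD m k x i : sc (m + k) x i = sc m x i * 2 ^+ k.
Proof. by rewrite /sc exprD mulrA. Qed.

Lemma ongridD m k x i : ongrid m x i -> ongrid (m + k) x i.
Proof.
move=> [C E]; exists (C * 2 ^+ k); rewrite scD E intrM rmorphXn /=.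
by rewrite -[2%:~R]/(2 : RR).
Qed.

Lemma ongrid_le m m' x i : (m <= m')%N -> ongrid m x i -> ongrid m' x i.
Proof. by move=> /subnKC <-; exact: ongridD. Qed.

Lemma onlevel_sub m x : onlevel m x -> U x.
Proof.
move=> h; pose z : {ffun 'I_n -> int} := [ffun i => Num.floor (sc m x i)].
have hz i : (z i)%:~R <= sc m x i <= (z i)%:~R + 1.
  rewrite ffunE; have := floor_itv (sc m x i).
  by rewrite intrD => /andP[-> /ltW ->].
by apply: (h z hz) => i; have /andP[h1 h2] := hz i; apply/andP; split; lra.
Qed.

Lemma adherent_le m m' x y : (m' <= m)%N -> adherent m x y -> adherent m' x y.
Proof.
move=> /subnKC E h i C; have := h i (C * 2 ^+ (m - m')%N).
rewrite -E !scD addKn intrM rmorphXn /= -[2%:~R]/(2 : RR).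
by rewrite !ler_pM2r ?sc_gt0.
Qed.

Lemma onlevel_adherent m m' x y : (m' <= m)%N -> adherent m x y ->
  onlevel m' x -> onlevel m' y.
Proof.
move=> /adherent_le mm /mm h hx z hz; apply: hx => i.
have [h1 _] := h i (z i); have [_ h2] := h i (z i + 1); rewrite intrD in h2.
by have /andP[z1 z2] := hz i; rewrite h1 //= h2.
Qed.

Lemma onlevel_ex x : open U -> U x -> exists m, onlevel m x.
Proof.
rewrite openE => oU Ux; have /nbhs_ballP[e /= e0 eU] := oU _ Ux.
have [m hm] : exists m, 4 < e * 2 ^+ m.
  exists (Num.truncn (4 / e)).+1; rewrite mulrC -ltr_pdivrMr //.
  apply: lt_le_trans (truncnS_gt _) _; rewrite -natrX ler_nat.
  exact/ltnW/ltn_expl.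
exists m => z hz y hy; apply: eU; rewrite mx_norm_ball /ball_ /=.
apply: norm_lt => // i; rewrite !mxE.
have : `|(x 0 i - y 0 i) * 2 ^+ m| < e * 2 ^+ m.
  rewrite mulrBl -/(sc m x i) -/(sc m y i) ltr_norml.
  by have /andP[h1 h2] := hz i; have /andP[h3 h4] := hy i; apply/andP; split; lra.
by rewrite normrM (gtr0_norm (sc_gt0 m)) ltr_pM2r // sc_gt0.
Qed.

Lemma level_ex x : open U -> U x -> exists m, level m x.
Proof.
move=> oU Ux; have [m0 hm0] := onlevel_ex oU Ux.
have ex : exists m, `[< onlevel m x >] by exists m0; apply/asboolP.
case: (ex_minnP ex) => m /asboolP hm hmin; exists m; split => // m' m'm h.
by have := hmin m'; rewrite leqNgt m'm => /(_ (asboolT h)).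
Qed.

Lemma level_le m m' x : level m x -> onlevel m' x -> (m <= m')%N.
Proof. by move=> [_ h] h'; rewrite leqNgt; apply/negP => /h. Qed.

(** * Open cells with a fixed set of directions, and their diamonds *)

Section Cells.
Variable D : {set 'I_n}.

(** The open face of the grid with lowest corner [z] and set of directions [D]; its dimension is
    [#|D|]. *)
Definition incell m z x := forall i, if i \in D
  then is_true ((z i)%:~R < sc m x i < (z i)%:~R + 1) else sc m x i = (z i)%:~R.
Definition uvec m z x : 'rV[RR]_n :=
  \row_i (if i \in D then sc m x i - (z i)%:~R - 2^-1 else 0).
Definition vvec m z x : 'rV[RR]_n :=
  \row_i (if i \in D then 0 else sc m x i - (z i)%:~R).
(* In the coordinates of [D], [2^-1 - `|u|] is the distance to the boundary of
   the cell; in the other ones [`|v|] is the distance to the cell. *)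
Definition diamond m z x := `|uvec m z x| + `|vvec m z x| < 2^-1.
Definition center m z : 'rV[RR]_n :=
  \row_i (((z i)%:~R + (if i \in D then 2^-1 else 0)) / 2 ^+ m).
(** The level is constant on an open cell, so it may be tested at the center. *)
Definition valid_cell m z := level m (center m z).
Definition cellproj m z x : 'rV[RR]_n :=
  \row_i (if i \in D then x 0 i else (z i)%:~R / 2 ^+ m).

Lemma scK m (c : RR) : c / 2 ^+ m * 2 ^+ m = c.
Proof. by rewrite divfK // gt_eqF // sc_gt0. Qed.

Lemma incell_center m z : incell m z (center m z).
Proof.
move=> i; rewrite /sc mxE scK; case: (i \in D); last by rewrite addr0.
by apply/andP; split; lra.
Qed.

(** The condition on [y] describes the open star of the cell of [x]. *)
Lemma incell_adherent m z x y : incell m z x ->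
  (forall i, if i \in D then (z i)%:~R < sc m y i < (z i)%:~R + 1
             else (z i)%:~R - 1 < sc m y i < (z i)%:~R + 1) ->
  adherent m x y.
Proof.
move=> hx hy i C; have := hx i; have := hy i.
case: ifP => _ /andP[y1 y2]; last first.
  move=> ->; split => hC; first by apply: intr_ltS; exact: le_lt_trans y2.
  by apply: intr_ltS; rewrite -ltrBlDr; exact: lt_le_trans hC.
move=> /andP[x1 x2]; split => hC.
  by apply: (le_trans _ (ltW x1)); apply: intr_ltS; exact: le_lt_trans y2.
by apply: (le_trans (ltW x2)); apply: intr_gtS; exact: lt_le_trans hC.
Qed.

Lemma adherent_incell m z x y : incell m z x -> incell m z y -> adherent m x y.
Proof.
move=> hx hy; apply: (incell_adherent hx) => i; have := hy i.
by case: ifP => // _ ->; apply/andP; split; lra.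
Qed.

Lemma incell_level_eq m z x y : incell m z x -> incell m z y ->
  level m x -> level m y.
Proof.
move=> hx hy [h1 h2].
split; first exact: (onlevel_adherent (leqnn _) (adherent_incell hx hy) h1).
move=> m' m'm hm'; apply: (h2 m' m'm).
exact: (onlevel_adherent (ltnW m'm) (adherent_incell hy hx) hm').
Qed.

Lemma incell_level m z x : incell m z x -> valid_cell m z -> level m x.
Proof. by move=> hx; apply: incell_level_eq hx; exact: incell_center. Qed.

Lemma level_incell m z x : incell m z x -> level m x -> valid_cell m z.
Proof. by move=> hx; apply: incell_level_eq hx _; exact: incell_center. Qed.

Lemma diamond_in m z x i : diamond m z x -> i \in D ->
  `|sc m x i - (z i)%:~R - 2^-1| + `|vvec m z x| < 2^-1.
Proof.
move=> d iD; apply: le_lt_trans d; rewrite lerD2r.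
by have := norm_coord (uvec m z x) i; rewrite mxE iD.
Qed.

Lemma diamond_in_itv m z x i : diamond m z x -> i \in D ->
  (z i)%:~R < sc m x i < (z i)%:~R + 1.
Proof.
move=> d iD; have := diamond_in d iD; have := normr_ge0 (vvec m z x) => h1 h2.
have : `|sc m x i - (z i)%:~R - 2^-1| < 2^-1 by lra.
by rewrite ltr_norml => /andP[h3 h4]; apply/andP; split; lra.
Qed.

Lemma diamond_out m z x i : diamond m z x -> i \notin D ->
  `|sc m x i - (z i)%:~R| < 2^-1.
Proof.
move=> d iD; have := norm_coord (vvec m z x) i; rewrite mxE (negbTE iD) => h.
by have := normr_ge0 (uvec m z x); move: d; rewrite /diamond; lra.
Qed.

Lemma incell_proj m z x : diamond m z x -> incell m z (cellproj m z x).
Proof.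
move=> d i; rewrite {1}/sc mxE; case: ifP => iD; last by rewrite /sc mxE iD scK.
by have := diamond_in_itv d iD; rewrite /sc mxE iD.
Qed.

Lemma diamond_adherent m z x : diamond m z x -> adherent m (cellproj m z x) x.
Proof.
move=> d; apply: (incell_adherent (incell_proj d)) => i; case: ifPn => iD.
  exact: diamond_in_itv.
by have := diamond_out d iD; rewrite ltr_norml => /andP[h1 h2]; apply/andP; split; lra.
Qed.

(** A diamond lies in the star of its cell. Consequently it stays inside [U], and its points have
    level at most [m]. *)
Lemma diamond_onlevel m z x : valid_cell m z -> diamond m z x -> onlevel m x.
Proof.
move=> v d; have [h _] := incell_level (incell_proj d) v.
exact: (onlevel_adherent (leqnn _) (diamond_adherent d) h).
Qed.

(** Within one grid [x] determines [z]: by integer parts in the directions of [D], by nearest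
    integers in the others. If [m < m'], the projection of [x] to the finer cell differs from the
    coarser cell by less than [1/2 + 1/4] of the coarse mesh in each direction outside [D]. It thus
    lies in the star of the coarser cell and satisfies the condition of level [m], against the
    minimality of [m']. *)
Lemma diamond_disj m z m' z' x : valid_cell m z -> valid_cell m' z' ->
  diamond m z x -> diamond m' z' x -> (m, z) = (m', z').
Proof.
wlog mm : m z m' z' / (m <= m')%N.
  by move=> H v v' d d'; have [/H|/ltnW/H E] := leqP m m'; [exact|apply/esym; exact: E].
move=> v v' d d'; move: mm; rewrite leq_eqVlt => /orP[/eqP E|mm].
  subst m'; congr pair; apply/ffunP => i; apply/eqP; rewrite eq_le -!(ler_int RR).
  case: (boolP (i \in D)) => iD.
    have /andP[h1 h2] := diamond_in_itv d iD; have /andP[h3 h4] := diamond_in_itv d' iD.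
    by apply/andP; split; apply: intr_ltS; lra.
  have := diamond_out d iD; have := diamond_out d' iD; rewrite !ltr_norml.
  by move=> /andP[h1 h2] /andP[h3 h4]; apply/andP; split; apply: intr_ltS; lra.
exfalso; have [_ /(_ m mm)] := incell_level (incell_proj d') v'; apply.
have [h _] := incell_level (incell_proj d) v.
apply: (onlevel_adherent (leqnn _) _ h).
apply: (incell_adherent (incell_proj d)) => i; case: ifPn => iD.
  by have := diamond_in_itv d iD; rewrite /sc mxE iD.
have k2 : 2 <= 2 ^+ (m' - m) :> RR.
  by rewrite -[X in X <= _]expr1 ler_weXn2l ?subn_gt0 // ler1n.
have mK := subnKC (ltnW mm).
have scE : sc m (cellproj m' z' x) i = (z' i)%:~R / 2 ^+ (m' - m).
  by rewrite /sc mxE (negbTE iD) -{1}mK exprD invfM mulrA mulrAC scK.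
have := diamond_out d iD; have := diamond_out d' iD; rewrite !ltr_norml scE.
rewrite -{1 2}mK !scD; move: k2; move: (2 ^+ (m' - m)) => K k2.
have K0 : 0 < K by lra.
move: (sc m x i) (z i)%:~R (z' i)%:~R => s Z Z' /andP[a1 a2] /andP[b1 b2].
have a3 : Z' / K - s < 4^-1.
  have : (Z' / K - s) * K < 2^-1 by rewrite mulrBl divfK ?gt_eqF //; lra.
  by move=> h3; nra.
have a4 : s - Z' / K < 4^-1.
  have : (s - Z' / K) * K < 2^-1 by rewrite mulrBl divfK ?gt_eqF //; lra.
  by move=> h3; nra.
by apply/andP; split; lra.
Qed.

(** Modifications inside the diamonds for [D] thus do not disturb cells whose directions fail to
    contain [D]. The level of [x] is at most [m], so a coordinate on its grid is also on the grid of
    the diamond, while the diamond stays strictly between grid values in the directions of [D]. *)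
Lemma diamond_off_grid m z m' x (D' : {set 'I_n}) : valid_cell m z ->
  diamond m z x -> level m' x -> ~~ (D \subset D') ->
  (forall i, i \notin D' -> ongrid m' x i) -> False.
Proof.
move=> v d lx /subsetPn[j jD jD'] h.
have mm : (m' <= m)%N by apply: level_le lx _; exact: diamond_onlevel d.
have [C E] := ongrid_le mm (h j jD').
have /andP[h1 h2] := diamond_in_itv d jD; rewrite E in h1 h2.
by have := intr_ltS h2; lra.
Qed.

(** The level cannot drop at a boundary point, since the condition would pass from there to the cell
    itself. The boundary may be subdivided by finer cells, but these have fewer directions than
    [D]. *)
Lemma cell_boundary m z m' x j : valid_cell m z ->
  (forall i, if i \in D then is_true ((z i)%:~R <= sc m x i <= (z i)%:~R + 1)
             else sc m x i = (z i)%:~R) ->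
  j \in D -> sc m x j = (z j)%:~R \/ sc m x j = (z j)%:~R + 1 ->
  level m' x -> forall i, i \notin D :\ j -> ongrid m' x i.
Proof.
move=> v hx jD hj lx i; rewrite in_setD1 negb_and negbK => hi.
have mm : (m <= m')%N.
  rewrite leqNgt; apply/negP => mm; have [_ /(_ m' mm)] := v; apply.
  have [h _] := lx; apply: (onlevel_adherent (ltnW mm) _ h) => k C.
  have := incell_center m z k; have := hx k; case: ifP => _; last by move=> -> ->.
  move=> /andP[x1 x2] /andP[c1 c2]; split => hC.
    by apply: le_trans x1; apply: intr_ltS; exact: le_lt_trans c2.
  by apply: (le_trans x2); apply: intr_gtS; exact: lt_le_trans hC.
apply: (ongrid_le mm); case/orP: hi => [/eqP ->|iD].
  by case: hj => E; [exists (z j)|exists (z j + 1); rewrite intrD].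
by have := hx i; rewrite (negbTE iD) => E; exists (z i).
Qed.

End Cells.
End Grid.

(** * Null sequences of loops *)

Lemma tube (X A : topologicalType) (H : RR * X -> A) (N : set A) (x0 : X) :
  continuous H -> open N -> (forall t : RR, 0 <= t <= 1 -> N (H (t, x0))) ->
  \forall x \near x0, forall t : RR, 0 <= t <= 1 -> N (H (t, x)).
Proof.
move=> cH oN h.
have /compact_near_coveringP nc := @segment_compact _ (0 : RR) 1.
have hyp (t : RR) : (`[0, 1]%classic : set RR) t -> \forall t' \near t & x \near x0, N (H (t', x)).
  rewrite /= in_itv /= => /h Nt.
  have := cH (t, x0) N (open_nbhs_nbhs (conj oN Nt)).
  by move=> -[[P Q] /= [nP nQ] PQ]; exists (P, Q) => //= p pPQ; exact: PQ.
have := nc X (nbhs x0) (fun x t => N (H (t, x))) (nbhs_filter x0) hyp.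
by apply: filterS => x sub t t01; apply: sub; rewrite /= in_itv.
Qed.

Lemma finite_nat_bound (S : set nat) : finite_set S ->
  exists M, forall i, S i -> (i < M)%N.
Proof.
move=> /finite_seqP[s ->]; exists (\max_(i <- s) i).+1 => i /= si.
by rewrite ltnS; apply: leq_bigmax_seq.
Qed.

Section NullSequences.
Variables (k : nat) (A : topologicalType) (a : A).

Definition null_family (T : Type) (f : nat -> T -> A) :=
  forall N : set A, open N -> N a -> finite_set [set i | exists y, ~ N (f i y)].

(* [Z] is the receptacle through which null sequences of [k]-loops factor:
   [H0T] for [k = 0] and [HkT k] for [k > 0]. *)
Lemma null_contraction_from (Z : topologicalType) (z0 : Z)
    (e : nat -> 'rV[RR]_k -> Z) (f : nat -> 'rV[RR]_k -> A) (G : Z -> A) :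
  based_classes_trivial z0 a ->
  (forall i, continuous (e i)) -> (forall i y, ~ opencube y -> e i y = z0) ->
  (forall O : set Z, open O -> O z0 -> finite_set [set i | exists y, ~ O (e i y)]) ->
  continuous G -> G z0 = a -> (forall i y, G (e i y) = f i y) ->
  exists h : nat -> RR * 'rV[RR]_k -> A,
    [/\ forall i, continuous (h i), forall i y, h i (0, y) = f i y,
        forall i y, h i (1, y) = a,
        forall i t y, ~ opencube y -> h i (t, y) = a & null_family h].
Proof.
move=> tr ce ez fin cG Gz Ge.
have [H [cH H01 Hz]] := tr G (fun=> a) (conj cG Gz) (conj (@cont_cst _ _ a) erefl).
have cl01 t : unit_interval (clamp01 t) by exact: clamp01_itv.
have cHc : continuous (fun p : RR * Z => H (clamp01 p.1, p.2)).
  apply: cont_within cH => [|p]; last by split => //=; exact: cl01.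
  by apply: cont_pair; [apply: cont_clamp01; exact: cont_fst|exact: cont_snd].
exists (fun i p => H (clamp01 p.1, e i p.2)); split.
- move=> i; apply: (@cont_comp _ _ _ (fun p : RR * 'rV[RR]_k => (p.1, e i p.2)) _ _ cHc).
  apply: cont_pair; first exact: cont_fst.
  by apply: cont_comp (ce i); exact: cont_snd.
- by move=> i y; rewrite clamp01_le0 //= (H01 _).1.
- by move=> i y; rewrite clamp01_ge1 //= (H01 _).2.
- by move=> i t y oy; rewrite ez //=; apply: Hz; exact: cl01.
- move=> N oN Na.
  (* The contraction fixes [z0], so by compactness of the time interval a whole neighbourhood of
     [z0] stays in [N]; almost all [e i] have their image in it. *)
  have : \forall z \near z0, forall t, 0 <= t <= 1 -> N (H (clamp01 t, z)).
    apply: (tube cHc oN) => t _ /=; rewrite Hz //; exact: cl01.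
  rewrite /prop_near1 /= nbhsE => -[Q [oQ Qz] QN].
  apply: sub_finite_set (fin Q oQ Qz) => i /= [[t y] /= nN]; exists y => Qe.
  apply: nN; have := QN _ Qe (clamp01 t) (clamp01_itv t).
  by rewrite (clamp01_id (clamp01_itv t)).
Qed.

End NullSequences.

Lemma H0_point_in i : (i.+1%:R : RR)^-1 \in H0set.
Proof. by apply/mem_set; right; exists i. Qed.
Definition H0_point i : H0T := exist (fun x => x \in H0set) _ (H0_point_in i).

Lemma cont_set_val (X : topologicalType) (S : set X) :
  continuous (fun s : set_type S => set_val s).
Proof. exact: initial_continuous. Qed.

Lemma cont_to_set_type (X Y : topologicalType) (S : set X) (f : Y -> set_type S) :
  continuous (fun y => set_val (f y)) -> continuous f.
Proof.
move=> cf; apply/continuousP => _ [W oW <-].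
by move/continuousP: cf => /(_ W oW).
Qed.

(** The only row of length 0 lies in the open cube vacuously. A null family is therefore a sequence
    of points converging to [a], that is, a based map on [H0T]. *)
Lemma null_contraction0 (A : topologicalType) (a : A) (f : nat -> 'rV[RR]_0 -> A) :
  based_classes_trivial H0pt a -> null_family a f ->
  exists h : nat -> RR * 'rV[RR]_0 -> A,
    [/\ forall i, continuous (h i), forall i y, h i (0, y) = f i y,
        forall i y, h i (1, y) = a,
        forall i t y, ~ opencube y -> h i (t, y) = a & null_family a h].
Proof.
move=> tr nf; pose x i := f i 0.
have fx i y : f i y = x i by rewrite /x; congr f; apply/rowP => -[].
pose G (s : H0T) := if pselect (exists m, set_val s = (m.+1%:R)^-1) is left e
  then x (projT1 (cid e)) else a.
have inv_inj m m' : (m.+1%:R)^-1 = (m'.+1%:R)^-1 :> RR -> m = m'.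
  by move=> /invr_inj/eqP; rewrite eqr_nat => /eqP[].
have G1 s m : set_val s = (m.+1%:R)^-1 -> G s = x m.
  move=> sm; rewrite /G; case: pselect => [e|]; last by case; exists m.
  by case: cid => m' /= sm'; congr x; apply: inv_inj; rewrite -sm -sm'.
have G0 s : set_val s = 0 -> G s = a.
  move=> s0; rewrite /G; case: pselect => // e; exfalso; case: e => m.
  by rewrite s0 => /esym/eqP; rewrite invr_eq0 pnatr_eq0.
have scase (s : H0T) : set_val s = 0 \/ exists m, set_val s = (m.+1%:R)^-1.
  by case: s => s hs; have := set_mem hs.
have cv := @cont_set_val _ H0set.
have cG : continuous G.
  move=> s W; rewrite nbhsE => -[V [oV Vs] VW].
  suff : \forall s' \near s, V (G s') by apply: filterS => y; exact: VW.
  case: (scase s) => [s0|[m sm]].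
    rewrite G0 // in Vs; have [M hM] := finite_nat_bound (nf V oV Vs).
    have : \forall s' \near s, set_val s' < (M.+1%:R)^-1.
      apply: (cv s [set t | t < (M.+1%:R)^-1]); apply: open_nbhs_nbhs.
      by split; [exact: open_lt|rewrite /= s0 invr_gt0 ltr0n].
    apply: filterS => s' hs'; case: (scase s') => [|[m sm]]; first by move/G0 ->.
    rewrite (G1 _ _ sm); apply: contrapT => nV.
    have mM : (m < M)%N by apply: hM; exists 0.
    have : (M.+1 < m.+1)%N by rewrite -(ltr_nat RR) -ltf_pV2 ?posrE ?ltr0n // -sm.
    by rewrite ltnS ltnNge (ltnW mM).
  have : \forall s' \near s, (m.+2%:R)^-1 < set_val s'.
    apply: (cv s [set t | (m.+2%:R)^-1 < t]); apply: open_nbhs_nbhs.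
    split; first exact: open_gt.
    by rewrite /= sm ltf_pV2 ?posrE ?ltr0n // ltr_nat.
  (* Together with the lower bound this isolates [1/(m+1)]. The upper bound [1/m] is written as a
     product in order to include [m = 0]. *)
  have : \forall s' \near s, set_val s' * m%:R < 1.
    apply: (@cont_comp _ _ _ set_val (fun t : RR => t * m%:R) cv _ s [set t | t < 1]).
      by apply: cont_mul; [exact: cont_id|exact: cont_cst].
    apply: open_nbhs_nbhs; split; first exact: open_lt.
    by rewrite /= sm mulrC ltr_pdivrMr ?ltr0n // mul1r ltr_nat.
  apply: filterS2 => s' h1 h2; case: (scase s') => [s0|[m' sm']].
    by move: h2; rewrite s0 invr_lt0 ltrn0.
  rewrite (G1 _ _ sm') (_ : m' = m) -?(G1 _ _ sm) //; apply/eqP; rewrite eqn_leq.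
  move: h1 h2; rewrite sm' mulrC ltr_pdivrMr ?ltr0n // mul1r ltr_nat ltnS => ->.
  by rewrite ltf_pV2 ?posrE ?ltr0n // ltr_nat !ltnS => ->.
apply: (@null_contraction_from _ _ _ _ H0pt (fun i _ => H0_point i) f G) => //.
- by move=> i; exact: cont_cst.
- by move=> i y /existsNP[[]].
- move=> O [W oW WO] Oz.
  have W0 : W 0 by move: Oz; rewrite -WO.
  have := @cvg_harmonic RR W (open_nbhs_nbhs (conj oW W0)).
  rewrite nbhs_simpl /= => -[M _ hM].
  apply: (sub_finite_set _ (finite_II M)) => i /= [y nO].
  rewrite ltnNge; apply/negP => Mi; apply: nO; rewrite -WO; exact: (hM i Mi).
- exact: G0.
- by move=> i y; rewrite fx; apply: G1.
Qed.

Lemma swedge_inj_continuous (X : nat -> topologicalType) (p0 : forall i, X i) i :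
  continuous (fun x : X i => swedge_inj p0 x : swedgeT p0).
Proof. by apply/continuousP => O [oO _]; exact: oO. Qed.

(** Continuity at the wedge point amounts to the [g i] forming a null family. *)
Lemma swedge_desc (X : nat -> topologicalType) (p0 : forall i, X i)
    (A : topologicalType) (a : A) (g : forall i, X i -> A) :
  (forall i, continuous (g i)) -> (forall i, g i (p0 i) = a) ->
  (forall N : set A, open N -> N a -> finite_set [set i | exists x, ~ N (g i x)]) ->
  exists G : swedgeT p0 -> A,
    continuous G /\ forall i x, G (swedge_inj p0 x) = g i x.
Proof.
move=> cg gp fin; pose G : swedgeT p0 -> A := wedge_fun g.
have GE i x : G (swedge_inj p0 x) = g i x.
  by apply: wedge_lift_funE => j k; rewrite !gp.
exists G; split => //; apply/continuousP => N oN; rewrite swedge_openE; split => [i|].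
  rewrite (_ : _ @^-1` _ = g i @^-1` N); first by move/continuousP: (cg i); exact.
  by apply/seteqP; split => x; rewrite /preimage /= GE.
rewrite /preimage /= GE gp => Na; apply: sub_finite_set (fin N oN Na) => i /= h.
apply: contrapT => h'; apply: h => _ [x _ <-] /=; rewrite GE.
by apply: contrapT => nN; apply: h'; exists x.
Qed.

(** * The sphere as the cube with its boundary collapsed *)

Section CubeToSphere.
Variable k' : nat.
Let k := k'.+1.
Implicit Types (y u : 'rV[RR]_k) (X : 'rV[RR]_k.+1).

(* Collapse of the boundary of the cube: inverse stereographic projection of
   [u / b], where [u = 2 y - 1] and [b = 1 - `|u|] vanishes on the boundary. *)
Definition cvec y : 'rV[RR]_k := \row_i (2 * clamp01 (y 0 i) - 1).
Definition depth y : RR := 1 - `|cvec y|.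
(** The depth uses the sup norm, whose unit ball is a cube; stereographic projection needs the
    squared Euclidean norm. *)
Definition sqn u : RR := \sum_i u 0 i ^+ 2.
Definition collapse_row y : 'rV[RR]_k.+1 := \row_i
  match unlift ord0 i with
  | Some j => 2 * depth y * cvec y 0 j / (sqn (cvec y) + depth y ^+ 2)
  | None => (sqn (cvec y) - depth y ^+ 2) / (sqn (cvec y) + depth y ^+ 2)
  end.

Lemma sqn_ge0 u : 0 <= sqn u.
Proof. by apply: sumr_ge0 => i _; exact: sqr_ge0. Qed.

Lemma sqn_eq0 u : sqn u = 0 -> u = 0.
Proof.
move=> /eqP; rewrite psumr_eq0 => [/allP h|i _]; last exact: sqr_ge0.
apply/rowP => i; rewrite mxE; apply/eqP; rewrite -sqrf_eq0.
exact: (h i (mem_index_enum i)).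
Qed.

Lemma collapse_den y : 0 < sqn (cvec y) + depth y ^+ 2.
Proof.
rewrite lt_neqAle addr_ge0 ?sqn_ge0 ?sqr_ge0 // andbT eq_sym; apply/eqP => h.
have s0 : sqn (cvec y) = 0 by have := sqn_ge0 (cvec y); have := sqr_ge0 (depth y); lra.
move: h; rewrite /depth (sqn_eq0 s0) normr0 subr0 expr1n => h.
have := sqn_ge0 (0 : 'rV[RR]_k); lra.
Qed.

Lemma collapse0 y : collapse_row y 0 ord0 =
  (sqn (cvec y) - depth y ^+ 2) / (sqn (cvec y) + depth y ^+ 2).
Proof. by rewrite mxE unlift_none. Qed.

Lemma collapseS y i : collapse_row y 0 (lift ord0 i) =
  2 * depth y * cvec y 0 i / (sqn (cvec y) + depth y ^+ 2).
Proof. by rewrite mxE liftK. Qed.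

Lemma collapse_in y : collapse_row y \in sphere k.
Proof.
apply/mem_set; rewrite /sphere /= big_ord_recl collapse0.
under eq_bigr => i _ do rewrite collapseS.
have -> : \sum_(i < k) (2 * depth y * cvec y 0 i / (sqn (cvec y) + depth y ^+ 2)) ^+ 2 =
  (2 * depth y / (sqn (cvec y) + depth y ^+ 2)) ^+ 2 * sqn (cvec y).
  rewrite /sqn mulr_sumr; apply: eq_bigr => i _.
  by rewrite -exprMn; congr (_ ^+ 2); rewrite mulrAC.
have := collapse_den y; move: (sqn _) (depth y) => s b sb.
by field; rewrite gt_eqF.
Qed.

Definition collapse y : sphereT k := exist (fun x => x \in sphere k) _ (collapse_in y).

Lemma cont_cvec : continuous cvec.
Proof.
apply: cont_row => i; apply: cont_sub; last exact: cont_cst.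
apply: cont_mul; first exact: cont_cst.
by apply: cont_clamp01; apply: cont_coord; exact: cont_id.
Qed.

Lemma collapse_continuous : continuous collapse.
Proof.
apply: cont_to_set_type; rewrite (_ : (fun y => _) = collapse_row) //.
have cd : continuous depth.
  by apply: cont_sub; [exact: cont_cst|apply: cont_norm; exact: cont_cvec].
have cs : continuous (fun y => sqn (cvec y)).
  apply: cont_sum => i; under eq_fun do rewrite expr2.
  by apply: cont_mul; apply: cont_coord; exact: cont_cvec.
have cd2 : continuous (fun y => depth y ^+ 2).
  by under eq_fun do rewrite expr2; exact: cont_mul.
have cq : continuous (fun y => (sqn (cvec y) + depth y ^+ 2)^-1).
  apply: cont_inv; last exact: cont_add.
  by move=> y; rewrite gt_eqF // collapse_den.
apply: cont_row => i; case: (unlift ord0 i) => [j|]; apply: cont_mul => //.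
  apply: cont_mul; last by apply: cont_coord; exact: cont_cvec.
  by apply: cont_mul => //; exact: cont_cst.
exact: cont_sub.
Qed.

Lemma cvec_abs y i : `|cvec y 0 i| <= 1.
Proof. by rewrite mxE ler_norml; have := clamp01_itv (y 0 i); lra. Qed.

Lemma depth_ge0 y : 0 <= depth y.
Proof. by rewrite /depth subr_ge0; apply: norm_le => // i; exact: cvec_abs. Qed.

Lemma depth_eq0 y : depth y = 0 <-> ~ opencube y.
Proof.
split => [d0 oy|].
  have : `|cvec y| < 1.
    apply: norm_lt => // i; rewrite mxE clamp01_id; last first.
      by have := oy i; lra.
    by rewrite ltr_norml; have := oy i; lra.
  by move: d0; rewrite /depth; lra.
move=> /existsNP[i /negP]; rewrite negb_and -!leNgt => hi.
have := depth_ge0 y; have := norm_coord (cvec y) i; rewrite mxE /depth.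
case/orP: hi => hi; [rewrite clamp01_le0 //|rewrite clamp01_ge1 //].
  by rewrite mulr0 sub0r normrN normr1; lra.
by rewrite mulr1 (_ : 2 - 1 = 1) ?normr1; lra.
Qed.

Lemma collapse_bdry y : ~ opencube y -> collapse y = sphere_pt k.
Proof.
move=> /depth_eq0 d0; apply: val_inj; rewrite /= /collapse_row d0.
have := collapse_den y; rewrite d0 expr0n addr0 => s0.
apply/rowP => i; rewrite !mxE; case: unliftP => [j ->|->].
  by rewrite mulr0 !mul0r.
by rewrite /= subr0 divff // gt_eqF.
Qed.

Lemma collapse_1sub y : 1 - collapse_row y 0 ord0 =
  2 * depth y ^+ 2 / (sqn (cvec y) + depth y ^+ 2).
Proof.
rewrite collapse0; have := collapse_den y; move: (sqn _) (depth y) => s b sb.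
by field; rewrite gt_eqF.
Qed.

(** Stereographic projection recovers [cvec / depth]; since the norm of [cvec] is [1 - depth], this
    quotient determines both. *)
Lemma collapse_inj y y' : opencube y -> collapse y = collapse y' -> y = y'.
Proof.
move=> oy /(congr1 set_val) E'; have E : collapse_row y = collapse_row y' by exact: E'.
have dN : depth y != 0 by apply/eqP => /depth_eq0.
have q0 := collapse_den y; have q0' := collapse_den y'.
have E0 := congr1 (fun X : 'rV[RR]_k.+1 => 1 - X 0 ord0) E.
rewrite /= !collapse_1sub in E0.
have dN' : depth y' != 0.
  apply: contra_neq dN => d0; move: E0; rewrite d0 expr0n mulr0 mul0r => /eqP.
  by rewrite !mulf_eq0 invr_eq0 (gt_eqF q0) pnatr_eq0 orbF /= orbb => /eqP.
have ES i : cvec y 0 i / depth y = cvec y' 0 i / depth y'.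
  have F z : depth z != 0 -> cvec z 0 i / depth z =
      collapse_row z 0 (lift ord0 i) / (1 - collapse_row z 0 ord0).
    move=> dz; rewrite collapse_1sub collapseS; have := collapse_den z.
    move: (sqn _) (depth z) dz (cvec z 0 i) => s b b0 c sb.
    by field; rewrite b0 gt_eqF.
  by rewrite !F // E.
have EV : depth y' *: cvec y = depth y *: cvec y'.
  apply/rowP => i; have := ES i; rewrite !mxE => h.
  have /eqP := h; rewrite eqr_div // => /eqP h'.
  by rewrite mulrC h' mulrC.
have D : depth y' = depth y.
  have := congr1 (fun u => `|u|) EV; rewrite !normrZ !ger0_norm ?depth_ge0 //.
  rewrite /depth; lra.
have CE : cvec y = cvec y'.
  by apply: (scalerI dN); rewrite -EV D.
have oy' : opencube y' by apply: contrapT => /depth_eq0 /eqP; rewrite (negbTE dN').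
apply/rowP => i; have := congr1 (fun u : 'rV[RR]_k => u 0 i) CE; rewrite !mxE.
by rewrite !clamp01_id; have := oy i; have := oy' i; lra.
Qed.

Lemma collapse_surj (s : sphereT k) : exists2 y, cube k y & collapse y = s.
Proof.
case: s => X hX; have := set_mem hX; rewrite /sphere /= big_ord_recl => hs.
set x0 := X 0 ord0 in hs.
have [x01|x01] := eqVneq x0 1.
  have S0 : \sum_(i < k) X 0 (lift ord0 i) ^+ 2 = 0 by rewrite x01 expr1n in hs; lra.
  have XS i : X 0 (lift ord0 i) = 0.
    move/eqP: S0; rewrite psumr_eq0 => [/allP h|j _]; last exact: sqr_ge0.
    by apply/eqP; rewrite -sqrf_eq0; exact: (h i (mem_index_enum i)).
  exists 0; first by move=> i; rewrite mxE lexx ler01.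
  rewrite collapse_bdry; last by move=> /(_ ord0); rewrite mxE ltxx.
  apply: val_inj => /=; apply/rowP => i; rewrite mxE.
  by case: (unliftP ord0 i) => [j ->|->]; rewrite ?XS // -/x0 x01.
have x0lt : x0 < 1.
  rewrite lt_neqAle x01 /=; have : 0 <= \sum_(i < k) X 0 (lift ord0 i) ^+ 2.
    by apply: sumr_ge0 => i _; exact: sqr_ge0.
  by move=> h; nra.
pose v : 'rV[RR]_k := \row_i (X 0 (lift ord0 i) / (1 - x0)).
(* The depth of the preimage, forced by [b * |v| = 1 - b]. *)
pose b := (1 + `|v|)^-1; have v0 := normr_ge0 v.
have b0 : 0 < b by rewrite invr_gt0; lra.
have bv : b * `|v| = 1 - b.
  by rewrite /b; field; lra.
pose y : 'rV[RR]_k := \row_i ((b * v 0 i + 1) / 2).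
have hv i : `|b * v 0 i| <= 1.
  rewrite normrM gtr0_norm //; have := norm_coord v i => h.
  have : b * `|v 0 i| <= b * `|v| by rewrite ler_pM2l.
  by rewrite bv; lra.
have cy : cube k y.
  by move=> i; rewrite [y _ _]mxE; have := hv i; rewrite ler_norml; lra.
have cE : cvec y = b *: v.
  by apply/rowP => i; rewrite mxE clamp01_id // [y _ _]mxE [RHS]mxE; field.
have dE : depth y = b by rewrite /depth cE normrZ gtr0_norm // bv; lra.
have sE : sqn (cvec y) = b ^+ 2 * ((1 + x0) / (1 - x0)).
  have -> : sqn (cvec y) = b ^+ 2 / (1 - x0) ^+ 2 * \sum_(i < k) X 0 (lift ord0 i) ^+ 2.
    rewrite /sqn mulr_sumr; apply: eq_bigr => i _; rewrite cE !mxE.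
    by field; lra.
  have -> : \sum_(i < k) X 0 (lift ord0 i) ^+ 2 = (1 - x0) * (1 + x0).
    have := hs; rewrite expr2 => h; nra.
  by field; lra.
exists y => //; apply: val_inj => /=; apply/rowP => i.
case: (unliftP ord0 i) => [j ->|->].
  rewrite collapseS sE dE cE 2!mxE; field.
  by rewrite (_ : b * b * _ + _ = 2 * (b * b)); [|ring]; nra.
rewrite collapse0 sE dE -/x0; field.
by rewrite (_ : b * b * _ + _ = 2 * (b * b)); [|ring]; nra.
Qed.

End CubeToSphere.

Lemma cube_compact k : compact (cube k).
Proof.
rewrite (_ : cube k = [set v | forall i, (`[0, 1]%classic : set RR) (v ord0 i)]).
  by apply: (@rV_compact RR k (fun=> `[0, 1]%classic)) => _; exact: segment_compact.
by apply/seteqP; split => v h i; have := h i; rewrite /= in_itv.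
Qed.

(** The collapse is a quotient map: the cube is compact, so images of closed subsets of it are
    closed. *)
Lemma sphere_factor k' (A : topologicalType) (a : A) (f : 'rV[RR]_k'.+1 -> A) :
  gloop a f -> exists g : sphereT k'.+1 -> A,
    continuous g /\ forall y, g (collapse y) = f y.
Proof.
move=> [cf fa]; pose g s := f (projT1 (cid2 (collapse_surj s))).
have gE y : g (collapse y) = f y.
  rewrite /g; case: cid2 => y' cy' E /=.
  have [oy|oy] := pselect (opencube y); first by rewrite (collapse_inj oy (esym E)).
  have [oy'|oy'] := pselect (opencube y'); last by rewrite !fa.
  by rewrite (collapse_inj oy' E).
exists g; split => //; apply/continuous_closedP => C cC.
have -> : g @^-1` C = set_val @^-1` (@collapse_row k' @` (cube _ `&` f @^-1` C)).
  apply/seteqP; split => s /=.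
    have [y cy <-] := collapse_surj s; rewrite gE => Cy; exists y => //.
  move=> [y [cy Cy] E]; have -> : s = collapse y by apply: val_inj.
  by rewrite gE.
apply: (@preimage_closed _ _ (fun s : sphereT k'.+1 => set_val s)).
  by move=> s _; exact: cont_set_val.
apply: compact_closed; first exact: norm_hausdorff.
apply: continuous_compact.
  apply: continuous_subspaceT.
  exact: (@cont_comp _ _ _ (@collapse k') (fun s : sphereT k'.+1 => set_val s)
    (@collapse_continuous k') (@cont_set_val _ _)).
apply: compact_closedI; first exact: cube_compact.
by apply: preimage_closed => // y _; exact: cf.
Qed.

(** For [k > 0] the loops factor through spheres, and the resulting maps form one based map on
    [HkT k], which is contracted as a whole. *)
Lemma null_contraction (k : nat) (A : topologicalType) (a : A) (f : nat -> 'rV[RR]_k -> A) m :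
  seq_connected m a -> (k <= m)%N -> (forall i, gloop a (f i)) -> null_family a f ->
  exists h : nat -> RR * 'rV[RR]_k -> A,
    [/\ forall i, continuous (h i), forall i y, h i (0, y) = f i y,
        forall i y, h i (1, y) = a,
        forall i t y, ~ opencube y -> h i (t, y) = a & null_family a h].
Proof.
case: k f => [|k'] f [c0 ck] km gf nf; first exact: null_contraction0.
pose G i := cid (sphere_factor (gf i)); pose g i := projT1 (G i).
have gc i : continuous (g i) := (projT2 (G i)).1.
have gE i y : g i (collapse y) = f i y := (projT2 (G i)).2 y.
pose p0 (_ : nat) := sphere_pt k'.+1.
have [||| F [cF FE]] := @swedge_desc _ p0 A a g.
- exact: gc.
- move=> i; have o0 : ~ opencube (0 : 'rV[RR]_k'.+1) by move=> /(_ ord0); rewrite mxE ltxx.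
  by rewrite -[p0 i](collapse_bdry o0) gE; have [_] := gf i; apply.
- move=> N oN Na; apply: sub_finite_set (nf N oN Na) => i /= [s].
  by have [y _ <-] := collapse_surj s; rewrite gE; exists y.
apply: (@null_contraction_from _ _ _ _ (Hkpt k'.+1)
  (fun i y => swedge_inj p0 (i := i) (collapse y)) f F).
- by apply: ck; rewrite km.
- move=> i; exact: (@cont_comp _ _ _ (@collapse k')
    (fun x => swedge_inj p0 (i := i) x : swedgeT p0)
    (@collapse_continuous k') (@swedge_inj_continuous _ p0 i)).
- by move=> i y oy; rewrite collapse_bdry // (swedge_inj_pt p0).
- move=> O oO Oz; have [_ /(_ Oz)] := oO; apply: sub_finite_set => i /= [y nO] h.
  by apply: nO; apply: h; exists (collapse y).
- exact: cF.
- have o0 : ~ opencube (0 : 'rV[RR]_k'.+1) by move=> /(_ ord0); rewrite mxE ltxx.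
  rewrite (_ : Hkpt _ = swedge_inj p0 (i := 0%N) (collapse 0)).
    by rewrite FE gE; have [_] := gf 0%N; apply.
  by rewrite collapse_bdry.
- by move=> i y; rewrite FE gE.
Qed.

(** * Trivializing a map on the cells *)

Section Finiteness.
Variables (n : nat) (U : set 'rV[RR]_n) (A : topologicalType) (a : A).
Hypothesis UC : forall x, U x -> opencube x.
Hypothesis hA : hausdorff_space A.
Variable f : 'rV[RR]_n -> A.
Hypothesis cf : continuous f.
Hypothesis fU : forall x, ~ U x -> f x = a.
Variables (N : set A).
Hypotheses (oN : open N) (Na : N a).

(** The points with value outside [N] form a compact set disjoint from the closed set where [f] is
    [a]. *)
Lemma dist_to_base : exists2 e : RR, 0 < e & forall x y, ~ N (f x) ->
  `|x - y| < e -> f y <> a.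
Proof.
have ox x : ~ N (f x) -> opencube x.
  by move=> h; apply: UC; apply: contrapT => /fU E; apply: h; rewrite E.
have cK : compact (cube n `&` f @^-1` (~` N)).
  apply: compact_closedI; first exact: cube_compact.
  by apply: preimage_closed => [x _|]; [exact: cf|exact: open_closedC].
have /compact_near_coveringP nc := cK.
have hyp x : (cube n `&` f @^-1` (~` N)) x ->
    \forall x' \near x & e \near (0 : RR)^'+, forall y, `|x' - y| < e -> f y <> a.
  move=> [_ Nx]; have fxa : f x <> a by move=> E; apply: Nx; rewrite E.
  have := @open_neq _ _ hA f (fun=> a) cf (@cont_cst _ _ a).
  rewrite openE => /(_ x fxa) /nbhs_ballP[r /= r0 rV].
  exists (ball x (r / 2), [set e | e < r / 2]) => /=.
    split; first by apply: nbhsx_ballx; rewrite divr_gt0.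
    by apply: nbhs_right_lt; rewrite divr_gt0.
  move=> [x' e] /= []; rewrite mx_norm_ball /ball_ /= => h1 h2 y h3.
  apply: rV; rewrite mx_norm_ball /ball_ /=.
  have -> : x - y = (x - x') + (x' - y) by rewrite addrA subrK.
  by apply: le_lt_trans (ler_normD _ _) _; lra.
have H := nc RR (0 : RR)^'+ (fun e x => forall y, `|x - y| < e -> f y <> a) _ hyp.
have := @filter_ex _ (0 : RR)^'+ _ _ (filterI (nbhs_right_gt (0 : RR)) (H _)).
case=> e [e0 he]; exists e => // x y Nx; apply: he.
by split => //; apply: opencube_cube; exact: ox.
Qed.

Variable D : {set 'I_n}.
Local Notation cell := (nat * {ffun 'I_n -> int})%type.

Lemma finite_cells (M : nat) (b : nat) : finite_set [set e : cell |
  (e.1 <= M)%N /\ forall i, - b%:Z <= e.2 i <= b%:Z].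
Proof.
pose g (w : 'I_M.+1 * {ffun 'I_n -> 'I_(b + b).+1}) : cell :=
  (val w.1, [ffun i => (val (w.2 i))%:Z - b%:Z]).
have : finite_set (range g) by apply: finite_image; exact: finite_finset.
apply: sub_finite_set => -[m z] /= [mM hz].
exists (Ordinal (mM : (m < M.+1)%N), [ffun i => inord (absz (z i + b%:Z))]) => //.
congr pair; apply/ffunP => i; rewrite !ffunE /= inordK; have /andP[h1 h2] := hz i; lia.
Qed.

(** By minimality, a cell of level [m + 1] violates the condition of level [m]: within two meshes
    [2^-m] of [x] there is a point outside [U], where [f] is [a]. For small meshes [dist_to_base]
    then puts [f x] into [N]. So the meshes of bad cells are bounded below, and only finitely many
    diamonds of such meshes meet the unit cube. *)
Lemma finite_bad_cells : finite_set [set e : cell | valid_cell U D e.1 e.2 /\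
  exists x, diamond D e.1 e.2 x /\ ~ N (f x)].
Proof.
have [e e0 he] := dist_to_base.
have [M hM] : exists M, 4 < e * 2 ^+ M.
  exists (Num.truncn (4 / e)).+1; rewrite mulrC -ltr_pdivrMr //.
  apply: lt_le_trans (truncnS_gt _) _; rewrite -natrX ler_nat.
  exact/ltnW/ltn_expl.
apply: sub_finite_set (finite_cells M.+1 (2 ^ M.+1).+1) => -[m z] /= [v [x [d Nx]]].
have Ux : U x by apply: contrapT => /fU E; apply: Nx; rewrite E.
have mM : (m <= M.+1)%N.
  rewrite leqNgt; apply/negP; case: m v d => // m v d; rewrite ltnS => mM.
  have [_ /(_ m (ltnSn m))] := incell_level (incell_proj d) v.
  move=> /existsNP[z' /not_implyP[pz' /existsNP[y /not_implyP[yz' nU]]]].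
  apply: (he x y Nx _ (fU nU)); apply: norm_lt => // i; rewrite !mxE.
  have Mm : 2 ^+ M <= 2 ^+ m :> RR by rewrite ler_weXn2l ?ler1n // ltnW.
  have : `|(x 0 i - y 0 i) * 2 ^+ m| < 4.
    rewrite mulrBl -/(sc m x i) -/(sc m y i).
    have : `|sc m x i - sc m (cellproj D m.+1 z x) i| < 1.
      have scS w : sc m w i = sc m.+1 w i / 2 by rewrite /sc exprS; field.
      rewrite !scS; case: (boolP (i \in D)) => iD.
        by rewrite /sc mxE iD subrr normr0.
      have := diamond_out d iD; have := incell_proj d i; rewrite (negbTE iD) => ->.
      by rewrite !ltr_norml; lra.
    by have := pz' i; have := yz' i; rewrite !ltr_norml; lra.
  rewrite normrM (gtr0_norm (sc_gt0 m)) => h; have s0 := sc_gt0 m.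
  rewrite -(ltr_pM2r s0); apply: (lt_le_trans h).
  by apply: (le_trans (ltW hM)); rewrite ler_pM2l.
split => // i; have m2 : (2 ^ m <= 2 ^ M.+1)%N by rewrite leq_exp2l.
have xi := UC Ux i; have s0 := sc_gt0 m.
have sx0 : 0 < sc m x i by rewrite mulr_gt0 //; case/andP: xi.
have sx1 : sc m x i < 2 ^+ m by rewrite /sc gtr_pMl //; case/andP: xi.
have : (z i)%:~R - 1 < sc m x i < (z i)%:~R + 1.
  case: (boolP (i \in D)) => iD.
    by have := diamond_in_itv d iD; lra.
  by have := diamond_out d iD; rewrite ltr_norml; lra.
move=> /andP[h1 h2].
have h3 : (z i)%:~R < ((2 ^ M.+1).+1%:Z)%:~R :> RR.
  have : 2 ^+ m <= (2 ^ M.+1)%:R :> RR by rewrite -natrX ler_nat.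
  by rewrite -natr1; lra.
have h4 : (- 1)%:~R < (z i)%:~R :> RR by rewrite -[(-1)%:~R]/(-1 : RR); lra.
move: h3 h4; rewrite !ltr_int; lia.
Qed.

End Finiteness.

(** * The homotopy near a single cell *)

Section CellHomotopy.
Variables (n : nat) (D : {set 'I_n}) (m : nat) (z : {ffun 'I_n -> int}).
Variables (A : topologicalType) (a : A).
Local Notation k := #|D|.
Implicit Types (x : 'rV[RR]_n) (w : 'rV[RR]_k) (t : RR).

(** Extension by zero from the directions in [D], as a sum with at most one nonzero term; this makes
    continuity in [w] immediate. *)
Definition extend_coord w (i : 'I_n) : RR :=
  \sum_(d < k) (if enum_val d == i then w 0 d else 0).
Definition cell_embed w : 'rV[RR]_n :=
  \row_i (((z i)%:~R + extend_coord w i) / 2 ^+ m).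
Definition cell_coord x : 'rV[RR]_k :=
  \row_d (sc m x (enum_val d) - (z (enum_val d))%:~R).

Lemma extend_coord_in w d : extend_coord w (enum_val d) = w 0 d.
Proof.
rewrite /extend_coord -big_mkcond /= (big_pred1 d) // => e.
by rewrite (inj_eq enum_val_inj).
Qed.

Lemma extend_coord_out w i : i \notin D -> extend_coord w i = 0.
Proof.
move=> iD; rewrite /extend_coord big1 // => d _; case: eqP => // E.
by move: iD; rewrite -E enum_valP.
Qed.

Lemma in_enum_val i : i \in D -> exists d : 'I_k, i = enum_val d.
Proof. by move=> iD; exists (enum_rank_in iD i); rewrite enum_rankK_in. Qed.

Lemma sc_cell_embed w i : sc m (cell_embed w) i = (z i)%:~R + extend_coord w i.
Proof. by rewrite /sc mxE scK. Qed.

Lemma cell_embed_coord x : cell_embed (cell_coord x) = cellproj D m z x.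
Proof.
apply/rowP => i; rewrite !mxE; case: ifPn => iD; last by rewrite extend_coord_out // addr0.
have [d ->] := in_enum_val iD; rewrite extend_coord_in mxE addrC subrK /sc.
by rewrite mulfK // gt_eqF // sc_gt0.
Qed.

Lemma cell_embed_continuous (X : topologicalType) (w : X -> 'rV[RR]_k) :
  continuous w -> continuous (fun p => cell_embed (w p)).
Proof.
move=> cw; apply: cont_row => i; apply: cont_mul; last exact: cont_cst.
apply: cont_add; first exact: cont_cst.
by apply: cont_sum => d; case: (_ == _); [exact: cont_coord|exact: cont_cst].
Qed.

Lemma cont_sc (X : topologicalType) (x : X -> 'rV[RR]_n) i :
  continuous x -> continuous (fun p => sc m (x p) i).
Proof. by move=> cx; apply: cont_mul; [exact: cont_coord|exact: cont_cst]. Qed.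

Definition alpha x : RR := 2^-1 - `|uvec D m z x|.
Definition beta x : RR := `|vvec D m z x|.
(** Whatever is within [thick t x] of the cell is squashed onto it. The first bound makes the
    squashing start from the identity, the second makes it trivial at the boundary of the diamond.
    Where [2 * beta x <= t * alpha x], both bounds are at least [beta x], so [x] itself reaches the
    cell. *)
Definition thick t x : RR := Num.max 0 (Num.min (t * alpha x / 2) (alpha x - beta x)).
Definition squash t x : 'rV[RR]_n := \row_i (if i \in D then x 0 i
  else (sc m x i - Num.max (- thick t x) (Num.min (thick t x) (sc m x i - (z i)%:~R))) / 2 ^+ m).

Lemma diamondE x : diamond D m z x <-> beta x < alpha x.
Proof. by rewrite /diamond /alpha /beta ltrBrDr addrC. Qed.

Lemma beta_ge0 x : 0 <= beta x. Proof. exact: normr_ge0. Qed.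

Lemma cont_uvec : continuous (uvec D m z).
Proof.
apply: cont_row => i; case: (i \in D); last exact: cont_cst.
by do 2 (apply: cont_sub; last exact: cont_cst); apply: cont_sc; exact: cont_id.
Qed.

Lemma cont_vvec : continuous (vvec D m z).
Proof.
apply: cont_row => i; case: (i \in D); first exact: cont_cst.
by apply: cont_sub; [apply: cont_sc; exact: cont_id|exact: cont_cst].
Qed.

Lemma cont_alpha : continuous alpha.
Proof. by apply: cont_sub; [exact: cont_cst|apply: cont_norm; exact: cont_uvec]. Qed.

Lemma cont_beta : continuous beta.
Proof. by apply: cont_norm; exact: cont_vvec. Qed.

Lemma cell_coord_continuous : continuous cell_coord.
Proof.
apply: cont_row => d; apply: cont_sub; last exact: cont_cst.
by apply: cont_sc; exact: cont_id.
Qed.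

Section Prod.
Variables (X : topologicalType) (t : X -> RR) (x : X -> 'rV[RR]_n).
Hypotheses (ct : continuous t) (cx : continuous x).

Lemma cont_alpha_comp : continuous (fun p => alpha (x p)).
Proof. exact: cont_comp cx cont_alpha. Qed.

Lemma cont_beta_comp : continuous (fun p => beta (x p)).
Proof. exact: cont_comp cx cont_beta. Qed.

Lemma cont_squash : continuous (fun p => squash (t p) (x p)).
Proof.
have ca := cont_alpha_comp; have cb := cont_beta_comp.
have ck : continuous (fun p => thick (t p) (x p)).
  apply: cont_max; first exact: cont_cst.
  apply: cont_min; last exact: cont_sub.
  by apply: cont_mul; [exact: cont_mul|exact: cont_cst].
apply: cont_row => i; case: (i \in D); first exact: cont_coord.
apply: cont_mul; last exact: cont_cst.
apply: cont_sub; first exact: cont_sc.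
apply: cont_max; first exact: cont_opp.
apply: cont_min => //; apply: cont_sub; [exact: cont_sc|exact: cont_cst].
Qed.

End Prod.

Lemma thick_ge0 t x : 0 <= thick t x.
Proof. by rewrite /thick le_max lexx. Qed.

Lemma squash_id t x : thick t x = 0 -> squash t x = x.
Proof.
move=> k0; apply/rowP => i; rewrite mxE k0 oppr0; case: ifP => // _.
rewrite (_ : Num.max 0 _ = 0); last by apply/max_idPl; rewrite ge_min lexx.
by rewrite subr0 /sc mulfK // gt_eqF // sc_gt0.
Qed.

Lemma squash_out t x : ~ diamond D m z x -> squash t x = x.
Proof.
move=> /diamondE/negP; rewrite -leNgt => h; apply: squash_id.
by rewrite /thick; apply/max_idPl; rewrite ge_min; apply/orP; right; lra.
Qed.

Lemma squash0 x : squash 0 x = x.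
Proof.
apply: squash_id; rewrite /thick !mul0r; apply/max_idPl.
by rewrite ge_min lexx.
Qed.

Lemma squash_diamond t x : diamond D m z x -> diamond D m z (squash t x).
Proof.
have scE i : i \in D -> sc m (squash t x) i = sc m x i by move=> iD; rewrite /sc mxE iD.
have scE' i : i \notin D -> sc m (squash t x) i =
    sc m x i - Num.max (- thick t x) (Num.min (thick t x) (sc m x i - (z i)%:~R)).
  by move=> iD; rewrite {1}/sc mxE (negbTE iD) scK.
rewrite /diamond (_ : uvec D m z (squash t x) = uvec D m z x); last first.
  by apply/rowP => i; rewrite !mxE; case: ifP => // iD; rewrite scE.
apply: le_lt_trans; rewrite lerD2l; apply: norm_le => [|i]; first exact: normr_ge0.
rewrite mxE; case: ifPn => iD; first by rewrite normr0 normr_ge0.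
have := norm_coord (vvec D m z x) i; rewrite mxE (negbTE iD); apply: le_trans.
rewrite scE' // addrAC; move: (thick_ge0 t x) => k0.
move: (thick t x) k0 (sc m x i - _) => c c0 s.
case: (leP c s) => h1; [case: (leP (- c) c) => h2|case: (leP (- c) s) => h2];
  by rewrite ler_norml; case: (ger0P s) => h3; apply/andP; split; lra.
Qed.

Lemma squash_proj t x : 0 <= t <= 1 -> 0 <= alpha x -> 2 * beta x <= t * alpha x ->
  squash t x = cellproj D m z x.
Proof.
move=> t01 a0 b0; apply/rowP => i; rewrite !mxE; case: ifPn => // iD.
have hb := norm_coord (vvec D m z x) i; rewrite mxE (negbTE iD) in hb.
have bt : beta x <= thick t x.
  rewrite /thick le_max le_min; apply/orP; right; apply/andP; split; first lra.
  have : t * alpha x <= alpha x by rewrite ler_piMl //; lra.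
  by move=> h; have := beta_ge0 x; lra.
have hs : `|sc m x i - (z i)%:~R| <= thick t x by exact: le_trans bt.
move: hs; rewrite ler_norml => /andP[h1 h2].
by rewrite (min_idPr h2) (max_idPr h1) opprB addrC subrK.
Qed.

Variables (f : 'rV[RR]_n -> A) (h : RR * 'rV[RR]_k -> A).
Hypotheses (cf : continuous f) (ch : continuous h).
Hypothesis fb : forall w, ~ opencube w -> f (cell_embed (clampv w)) = a.
Hypothesis h0 : forall w, h (0, w) = f (cell_embed (clampv w)).
Hypothesis h1 : forall w, h (1, w) = a.
Hypothesis ha : forall t w, ~ opencube w -> h (t, w) = a.

(* Near the cell the map is first squashed onto the cell, which makes room for
   the null-homotopy [h] of its restriction to the cell. *)
Definition cell_homotopy (p : RR * 'rV[RR]_n) : A :=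
  let t := clamp01 p.1 in let x := p.2 in
  if (0 < alpha x) && (2 * beta x < t * alpha x)
  then h (t - 2 * beta x / alpha x, cell_coord x) else f (squash t x).

Lemma alpha_opencube x : 0 < alpha x -> opencube (cell_coord x).
Proof.
move=> a0 d; rewrite mxE; have := norm_coord (uvec D m z x) (enum_val d).
rewrite mxE enum_valP ler_norml; move: a0; rewrite /alpha => a0 /andP[? ?].
by apply/andP; split; lra.
Qed.

Lemma opencube_alpha x : opencube (cell_coord x) -> 0 < alpha x.
Proof.
move=> o; rewrite /alpha subr_gt0; apply: norm_lt; first by rewrite invr_gt0.
move=> i; rewrite mxE; case: ifPn => iD; last by rewrite normr0 invr_gt0.
have [d E] := in_enum_val iD; have := o d; rewrite mxE -E ltr_norml; lra.
Qed.

(** At the interface of the two formulas of [cell_homotopy], the time [t - 2 * beta x / alpha x] is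
    0 and [x] is squashed exactly onto the cell, where [h] starts. *)
Lemma squash_eq t x : 0 <= t <= 1 -> 0 < alpha x -> 2 * beta x = t * alpha x ->
  f (squash t x) = h (0, cell_coord x).
Proof.
move=> t01 a0 E; rewrite (squash_proj t01 (ltW a0)) ?E // h0 clampv_id ?cell_embed_coord //.
by apply: opencube_cube; exact: alpha_opencube.
Qed.

Lemma cell_homotopy_continuous : continuous cell_homotopy.
Proof.
have cfst := @cont_fst RR 'rV[RR]_n; have csnd := @cont_snd RR 'rV[RR]_n.
have ct : continuous (fun p : RR * 'rV[RR]_n => clamp01 p.1) by exact: cont_clamp01.
have ca : continuous (fun p : RR * 'rV[RR]_n => alpha p.2) by exact: cont_alpha_comp.
have cb : continuous (fun p : RR * 'rV[RR]_n => beta p.2) by exact: cont_beta_comp.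
have cd : continuous (fun p : RR * 'rV[RR]_n => clamp01 p.1 * alpha p.2 - 2 * beta p.2).
  by apply: cont_sub; apply: cont_mul => //; exact: cont_cst.
have cw : continuous (fun p : RR * 'rV[RR]_n => cell_coord p.2).
  exact: cont_comp csnd cell_coord_continuous.
have cP : continuous (fun p : RR * 'rV[RR]_n => f (squash (clamp01 p.1) p.2)).
  by apply: cont_comp cf; exact: cont_squash.
have near_pos (g : RR * 'rV[RR]_n -> RR) p : continuous g -> 0 < g p ->
    \forall q \near p, 0 < g q.
  move=> cg gp; apply: (cg p [set s | 0 < s]); apply: open_nbhs_nbhs.
  by split => //; exact: open_gt.
move=> p W; rewrite nbhsE => -[V [oV Vp] VW].
suff : \forall q \near p, V (cell_homotopy q) by apply: filterS => q; exact: VW.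
have nP : V (f (squash (clamp01 p.1) p.2)) ->
    \forall q \near p, V (f (squash (clamp01 q.1) q.2)).
  by move=> VP; apply: (cP p V); exact: open_nbhs_nbhs.
have t01 := clamp01_itv p.1.
have [a0|a0] := ltP 0 (alpha p.2).
  (* As [alpha] vanishes at some points, the denominator is bounded below; [Q] is continuous
     everywhere and agrees with the first formula near [p]. *)
  pose Q (q : RR * 'rV[RR]_n) := h (clamp01 q.1 -
    2 * beta q.2 / Num.max (alpha p.2 / 2) (alpha q.2), cell_coord q.2).
  have cQ : continuous Q.
    apply: cont_comp ch; apply: cont_pair => //; apply: cont_sub => //.
    apply: cont_mul; first by apply: cont_mul => //; exact: cont_cst.
    apply: cont_inv; last by apply: cont_max => //; exact: cont_cst.
    by move=> q; rewrite gt_eqF // lt_max divr_gt0.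
  have na : \forall q \near p, 0 < alpha q.2 - alpha p.2 / 2.
    by apply: (near_pos (fun q => alpha q.2 - alpha p.2 / 2)); [apply: cont_sub => //; exact: cont_cst|lra].
  have QE q : 0 < alpha q.2 - alpha p.2 / 2 ->
      Q q = h (clamp01 q.1 - 2 * beta q.2 / alpha q.2, cell_coord q.2).
    by move=> hq; rewrite /Q (max_idPr _) //; lra.
  have nQ : V (Q p) -> \forall q \near p, V (Q q).
    by move=> VQ; apply: (cQ p V); exact: open_nbhs_nbhs.
  have Ep : 0 < alpha p.2 - alpha p.2 / 2 by lra.
  have [lt|gt|eq] := ltgtP (2 * beta p.2) (clamp01 p.1 * alpha p.2).
  - have n1 : \forall q \near p, 0 < clamp01 q.1 * alpha q.2 - 2 * beta q.2.
      by apply: (near_pos _ _ cd); lra.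
    have {}nQ : \forall q \near p, V (Q q).
      by apply: nQ; move: Vp; rewrite /cell_homotopy a0 lt /= -QE.
    near=> q; have aq : 0 < alpha q.2 - alpha p.2 / 2 by near: q.
    have lq : 0 < clamp01 q.1 * alpha q.2 - 2 * beta q.2 by near: q.
    rewrite /cell_homotopy (_ : _ && _); last by apply/andP; split; lra.
    by rewrite -QE //; near: q.
  - have n1 : \forall q \near p, 0 < - (clamp01 q.1 * alpha q.2 - 2 * beta q.2).
      apply: (near_pos (fun q => - (clamp01 q.1 * alpha q.2 - 2 * beta q.2))); last lra.
      exact: cont_opp.
    have {}nP : \forall q \near p, V (f (squash (clamp01 q.1) q.2)).
      apply: nP; move: Vp; rewrite /cell_homotopy (_ : _ && _ = false) //.
      by apply/negbTE; rewrite negb_and -!leNgt; apply/orP; right; lra.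
    near=> q; have lq : 0 < - (clamp01 q.1 * alpha q.2 - 2 * beta q.2) by near: q.
    rewrite /cell_homotopy (_ : _ && _ = false); first by near: q.
    by apply/negbTE; rewrite negb_and -!leNgt; apply/orP; right; lra.
  - have VP : V (f (squash (clamp01 p.1) p.2)).
      by move: Vp; rewrite /cell_homotopy eq ltxx andbF.
    have {}nP := nP VP.
    have {}nQ : \forall q \near p, V (Q q).
      apply: nQ; rewrite QE // eq mulfK ?gt_eqF // subrr.
      by rewrite -(squash_eq t01 a0 eq).
    near=> q; have aq : 0 < alpha q.2 - alpha p.2 / 2 by near: q.
    by rewrite /cell_homotopy; case: ifP => _; [rewrite -QE //|]; near: q.
have Np : ~ opencube (cell_coord p.2).
  by move=> /opencube_alpha; rewrite ltNge a0.
have VP : V (f (squash (clamp01 p.1) p.2)).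
  by move: Vp; rewrite /cell_homotopy ltNge a0.
have {}nP := nP VP.
have out q : ~ (0 < alpha q.2 /\ 2 * beta q.2 < clamp01 q.1 * alpha q.2) ->
    cell_homotopy q = f (squash (clamp01 q.1) q.2).
  by move=> nq; rewrite /cell_homotopy; case: ifP => // /andP.
have [an|an] := ltP (alpha p.2) 0.
  have n1 : \forall q \near p, 0 < - alpha q.2.
    by apply: (near_pos (fun q => - alpha q.2)); [exact: cont_opp|lra].
  near=> q; have lq : 0 < - alpha q.2 by near: q.
  by rewrite out; [near: q|lra].
have aE : alpha p.2 = 0 by apply/eqP; rewrite eq_le a0 an.
have [bp|bp] := ltP 0 (beta p.2).
  have n1 : \forall q \near p, 0 < - (clamp01 q.1 * alpha q.2 - 2 * beta q.2).
    apply: (near_pos (fun q => - (clamp01 q.1 * alpha q.2 - 2 * beta q.2))).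
      exact: cont_opp.
    by rewrite aE; lra.
  near=> q; have lq : 0 < - (clamp01 q.1 * alpha q.2 - 2 * beta q.2) by near: q.
  by rewrite out; [near: q|lra].
(* Here [p.2] is on the boundary of the cell, where [2 * beta / alpha] has no limit. The value is
   [a], and near the boundary [h] stays in [V] at all times, by compactness of the time interval. *)
have bE : beta p.2 = 0 by apply/eqP; rewrite eq_le bp beta_ge0.
have Va : V a.
  have E : cell_embed (clampv (cell_coord p.2)) = p.2.
    rewrite clampv_id; last first.
      move=> d; rewrite mxE; have := norm_coord (uvec D m z p.2) (enum_val d).
      rewrite mxE enum_valP ler_norml; move: aE; rewrite /alpha => aE /andP[? ?].
      by apply/andP; split; lra.
    rewrite cell_embed_coord -(@squash_proj 0) ?aE ?bE ?mulr0 ?lexx ?ler01 //.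
    by rewrite squash0.
  have := fb Np; rewrite E => <-.
  by move: VP; rewrite squash_out // => /diamondE; rewrite aE bE ltxx.
have nh : \forall w \near cell_coord p.2, forall t : RR, 0 <= t <= 1 -> V (h (t, w)).
  by apply: (tube ch oV) => t _; rewrite ha.
have {}nh : \forall q \near p, forall t : RR, 0 <= t <= 1 -> V (h (t, cell_coord q.2)).
  exact: (cw p _ nh).
near=> q; rewrite /cell_homotopy; case: ifP => [/andP[aq bq]|_]; last by near: q.
have := clamp01_itv q.1 => /andP[q0 q1].
have hq : forall t : RR, 0 <= t <= 1 -> V (h (t, cell_coord q.2)) by near: q.
apply: hq; have b0 := beta_ge0 q.2.
have : 0 <= 2 * beta q.2 / alpha q.2 < clamp01 q.1.
  by rewrite ltr_pdivrMr // bq andbT divr_ge0 //; lra.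
by move=> /andP[? ?]; apply/andP; split; lra.
Unshelve. all: by end_near. Qed.

Lemma cell_homotopy_out t x : ~ diamond D m z x -> cell_homotopy (t, x) = f x.
Proof.
move=> nd; rewrite /cell_homotopy /= squash_out //; case: ifP => // /andP[a0 b0].
exfalso; apply: nd; apply/diamondE; have /andP[t0 t1] := clamp01_itv t.
have : clamp01 t * alpha x <= alpha x by rewrite ler_piMl // ltW.
by have := beta_ge0 x; lra.
Qed.

Lemma cell_homotopy0 x : cell_homotopy (0, x) = f x.
Proof.
rewrite /cell_homotopy /= clamp01_le0 // squash0 mul0r ifF //.
by apply/negbTE; rewrite negb_and -!leNgt; apply/orP; right; have := beta_ge0 x; lra.
Qed.

Lemma cell_homotopy1 x : incell D m z x -> cell_homotopy (1, x) = a.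
Proof.
move=> hx; have bE : beta x = 0.
  apply/eqP; rewrite normr_eq0; apply/eqP/rowP => i; rewrite !mxE.
  by have := hx i; case: ifP => // _ ->; rewrite subrr.
have a0 : 0 < alpha x.
  apply: opencube_alpha => d; rewrite mxE; have := hx (enum_val d).
  by rewrite enum_valP => /andP[? ?]; apply/andP; split; lra.
by rewrite /cell_homotopy /= clamp01_ge1 // bE mulr0 mul0r subr0 mul1r a0 h1.
Qed.

Lemma incell_diamond x : incell D m z x -> diamond D m z x.
Proof.
move=> hx; apply/diamondE; have bE : beta x = 0.
  apply/eqP; rewrite normr_eq0; apply/eqP/rowP => i; rewrite !mxE.
  by have := hx i; case: ifP => // _ ->; rewrite subrr.
rewrite bE; apply: opencube_alpha => d; rewrite mxE; have := hx (enum_val d).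
by rewrite enum_valP => /andP[? ?]; apply/andP; split; lra.
Qed.

Lemma cell_homotopy_in t x (N : set A) : diamond D m z x ->
  (forall y, diamond D m z y -> N (f y)) -> (forall p, N (h p)) ->
  N (cell_homotopy (t, x)).
Proof.
move=> d Nf Nh; rewrite /cell_homotopy; case: ifP => _ //=.
by apply: Nf; exact: squash_diamond.
Qed.

End CellHomotopy.

(** * Killing the cells by increasing dimension *)

Section Killing.
Variables (n : nat) (U : set 'rV[RR]_n) (A : topologicalType) (a : A) (c : nat).
Hypothesis oU : open U.
Hypothesis UC : forall x, U x -> opencube x.
Hypothesis hA : hausdorff_space A.
Hypothesis conn : seq_connected c a.
Implicit Types (f : 'rV[RR]_n -> A) (D : {set 'I_n}).

Local Notation cell := (nat * {ffun 'I_n -> int})%type.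

(* The directions of the open cell of [x] are the coordinates in which [x] is
   off the grid of its level. *)
Definition killed f D := forall m x, level U m x ->
  (forall i, i \notin D -> ongrid m x i) -> f x = a.

Lemma incell_embed m z D (w : 'rV[RR]_#|D|) : opencube w ->
  incell D m z (cell_embed m z w).
Proof.
move=> ow i; rewrite sc_cell_embed; case: ifPn => iD; last first.
  by rewrite extend_coord_out // addr0.
have [d ->] := in_enum_val iD; rewrite extend_coord_in.
by have /andP[? ?] := ow d; apply/andP; split; lra.
Qed.

Section Stage.
Variables (D : {set 'I_n}) (f : 'rV[RR]_n -> A).
Hypothesis Dc : (#|D| <= c)%N.
Hypothesis cf : continuous f.
Hypothesis fU : forall x, ~ U x -> f x = a.
Hypothesis fD : forall j, j \in D -> killed f (D :\ j).

(** A boundary point in [U] belongs to a cell with directions in some [D :\ j], where [f] is trivial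
    already; hence [f] restricts to a loop on the cell. *)
Lemma cell_embed_bdry m z (w : 'rV[RR]_#|D|) : valid_cell U D m z ->
  ~ opencube w -> f (cell_embed m z (clampv w)) = a.
Proof.
move=> v /clampv_bdry[cw [d wd]]; set x := cell_embed m z _.
have [Ux|/fU//] := pselect (U x).
have [m' lx] := level_ex oU Ux.
apply: (fD (enum_valP d) lx); apply: (cell_boundary v) lx => //.
- move=> i; rewrite sc_cell_embed; case: ifPn => iD; last first.
    by rewrite extend_coord_out // addr0.
  have [e ->] := in_enum_val iD; rewrite extend_coord_in.
  by have /andP[? ?] := cw e; apply/andP; split; lra.
- exact: enum_valP.
- by rewrite sc_cell_embed extend_coord_in; case: wd => ->; [left|right]; rewrite ?addr0.
Qed.

Definition cell_loop (e : cell) (w : 'rV[RR]_#|D|) : A :=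
  if pselect (valid_cell U D e.1 e.2) then f (cell_embed e.1 e.2 (clampv w)) else a.

(** Null families are indexed by numbers, so cells are replaced by their codes; a number that codes
    no cell gets the constant loop. *)
Definition cell_loop_seq (i : nat) : 'rV[RR]_#|D| -> A :=
  if pickle_inv i is Some e then cell_loop e else fun=> a.

Lemma cell_loop_gloop e : gloop a (cell_loop e).
Proof.
rewrite /cell_loop; case: pselect => v; last by split => //; exact: cont_cst.
split => [|w ow]; last exact: cell_embed_bdry.
apply: cont_comp cf; apply: cell_embed_continuous; apply: cont_clampv; exact: cont_id.
Qed.

Lemma cell_loop_seq_null : null_family a cell_loop_seq.
Proof.
move=> N oN Na.
have := finite_bad_cells UC hA cf fU oN Na D.
move=> /(finite_image pickle); apply: sub_finite_set => i /= [w].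
rewrite /cell_loop_seq; case E: (pickle_inv i) => [e|] //.
rewrite /cell_loop; case: pselect => // v /= nN.
have pe : oapp pickle i (pickle_inv i : option cell) = i by exact: pickle_invK.
rewrite E /= in pe.
exists e => //; split => //; exists (cell_embed e.1 e.2 (clampv w)); split => //.
have ow : opencube w.
  by apply: contrapT => /(cell_embed_bdry v) E'; apply: nN; rewrite E'.
rewrite clampv_id; last exact: opencube_cube.
by apply: incell_diamond; exact: incell_embed.
Qed.

(** All valid cells with directions [D] are treated at once, their diamonds being disjoint. The last
    clause ensures that earlier stages are not undone. *)
Lemma kill_stage : exists H : RR * 'rV[RR]_n -> A,
  [/\ continuous H, forall x, H (0, x) = f x, forall t x, ~ U x -> H (t, x) = a,
      killed (fun x => H (1, x)) D &
      forall D', ~~ (D \subset D') -> killed f D' -> killed (fun x => H (1, x)) D'].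
Proof.
have [h [ch h0 h1 ha hn]] := null_contraction conn Dc
  (fun i => match pickle_inv i as o return gloop a (if o is Some e then cell_loop e else fun=> a)
            with Some e => cell_loop_gloop e
            | None => conj (@cont_cst _ _ a) (fun _ _ => erefl) end) cell_loop_seq_null.
pose he (e : cell) := h (pickle e).
have he0 (e : cell) w : valid_cell U D e.1 e.2 ->
    he e (0, w) = f (cell_embed e.1 e.2 (clampv w)).
  by move=> v; rewrite /he h0 /cell_loop_seq pickleK_inv /cell_loop; case: pselect.
pose He (e : cell) (p : RR * 'rV[RR]_n) : A :=
  if pselect (valid_cell U D e.1 e.2) then cell_homotopy e.1 e.2 f (he e) p else f p.2.
have HeE e p : He e p <> f p.2 -> valid_cell U D e.1 e.2 /\ diamond D e.1 e.2 p.2.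
  rewrite /He; case: pselect => // v ne; split => //; apply: contrapT => nd.
  by apply: ne; case: p nd => t x nd; rewrite cell_homotopy_out.
have disj e e' p : He e p <> f p.2 -> He e' p <> f p.2 -> e = e'.
  move=> /HeE[v d] /HeE[v' d']; have := diamond_disj v v' d d'.
  by case: e e' {v d v' d'} => ? ? [? ?].
pose H := glue (fun p : RR * 'rV[RR]_n => f p.2) He.
have HE e t x : valid_cell U D e.1 e.2 -> diamond D e.1 e.2 x ->
    H (t, x) = cell_homotopy e.1 e.2 f (he e) (t, x).
  move=> v d; have HeV : He e (t, x) = cell_homotopy e.1 e.2 f (he e) (t, x).
    by rewrite /He; case: pselect.
  have [E|ne] := pselect (He e (t, x) = f x); last by rewrite -HeV; exact: glueE.
  rewrite -HeV E; apply: (glue_out (f := fun p : RR * 'rV[RR]_n => f p.2)) => e'.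
  apply: contrapT => ne; have [v' d'] := HeE e' (t, x) ne.
  have := diamond_disj v v' d d'; move: ne E; case: (e) => ? ? /=; case: (e') => ? ? ne E [E1 E2].
  by apply: ne; rewrite -E1 -E2.
have Hout t x : (forall e : cell, valid_cell U D e.1 e.2 -> ~ diamond D e.1 e.2 x) ->
    H (t, x) = f x.
  move=> nd; apply: (glue_out (f := fun p : RR * 'rV[RR]_n => f p.2)) => e.
  by apply: contrapT => /HeE[v]; exact: nd.
have keep D' : ~~ (D \subset D') -> killed f D' -> killed (fun x => H (1, x)) D'.
  move=> DD' kD' m x lx gx; rewrite Hout; first exact: kD' lx gx.
  by move=> e v d; exact: diamond_off_grid v d lx DD' gx.
exists H; split => //.
- apply: (@glue_continuous _ _ _ (fun p : RR * 'rV[RR]_n => f p.2) He _ _ a) => //.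
  + exact: cont_comp (@cont_snd _ _) cf.
  + move=> e; rewrite /He; case: pselect => v; last exact: cont_comp (@cont_snd _ _) cf.
    apply: (@cell_homotopy_continuous _ _ _ _ _ a) => //.
    * exact: ch.
    * by move=> w; exact: cell_embed_bdry.
    * by move=> w; exact: he0.
    * by move=> t w ow; rewrite /he ha.
  + move=> N oN Na.
    (* A member can leave [N] only if [f] does so on its diamond or if its null-homotopy does; each
       happens for finitely many cells. *)
    have F1 := finite_bad_cells UC hA cf fU oN Na D.
    have F2 : finite_set (pickle @^-1` [set i | exists p, ~ N (h i p)] : set cell).
      apply: finite_preimage (hn N oN Na) => e e' _ _; exact: (pcan_inj pickleK).
    have := conj F1 F2; rewrite -finite_setU.
    apply: sub_finite_set => e /= [[t x] [/HeE[v d] nN]].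
    apply: contrapT => /not_orP[n1 n2]; apply: nN.
    have Nf y : diamond D e.1 e.2 y -> N (f y).
      by move=> dy; apply: contrapT => nf; apply: n1; split => //; exists y.
    split; last exact: Nf.
    rewrite /He; case: pselect => // v' /=; apply: cell_homotopy_in => // p.
    by apply: contrapT => np; apply: n2; exists p.
- move=> x; rewrite -[RHS]/((fun p : RR * 'rV[RR]_n => f p.2) (0, x)).
  apply: glue_out => e; rewrite /He; case: pselect => // v.
  exact: cell_homotopy0.
- move=> t x nU; rewrite Hout; first exact: fU.
  by move=> e v d; apply: nU; exact: onlevel_sub (diamond_onlevel v d).
move=> m x lx gx.
(* A point that is on the grid in some direction of [D] belongs to a lower cell, trivial before and
   left alone; otherwise it lies in an open cell that has just been contracted. *)
have [[j jD gj]|nj] := pselect (exists2 j, j \in D & ongrid m x j).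
  apply: (keep (D :\ j) _ (fD jD)) lx _.
    by apply/negP => /fintype.subsetP/(_ j jD); rewrite in_setD1 eqxx.
  move=> i; rewrite in_setD1 negb_and negbK => /orP[/eqP ->//|]; exact: gx.
pose z : {ffun 'I_n -> int} := [ffun i => Num.floor (sc m x i)].
have hx : incell D m z x.
  move=> i; rewrite ffunE; case: ifPn => iD.
    have /andP[f1 f2] := floor_itv (sc m x i); rewrite intrD in f2.
    rewrite f2 andbT lt_neqAle f1 andbT; apply/eqP => E; apply: nj.
    by exists i => //; exists (Num.floor (sc m x i)).
  by have [C ->] := gx i iD; rewrite floorK // intr_int.
have v : valid_cell U D m z by exact: level_incell hx lx.
rewrite (HE (m, z)) //=; last exact: incell_diamond.
apply: cell_homotopy1 => //.
by move=> w; rewrite /he h1.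
Qed.

End Stage.
End Killing.

Section KillAll.
Variables (n : nat) (A : topologicalType) (a : A) (c : nat).
Hypothesis hA : hausdorff_space A.
Hypothesis conn : seq_connected c a.
Variable f0 : 'rV[RR]_n -> A.
Hypothesis gf0 : gloop a f0.

Local Notation U := [set x | f0 x <> a].

Lemma open_supp : open U.
Proof. by apply: (open_neq hA (g := f0)) gf0.1 _; exact: cont_cst. Qed.

Lemma supp_opencube x : U x -> opencube x.
Proof. by move=> h; apply: contrapT => /(gf0.2 x). Qed.

(** [U] is the support of the initial [f0]; it is kept, with its cell decomposition, through all
    stages. *)
Definition admissible (f : 'rV[RR]_n -> A) :=
  [/\ continuous f, (forall x, ~ U x -> f x = a) & ghom a (~` U) f0 f].

Lemma admissible0 : admissible f0.
Proof.
have h x : ~ U x -> f0 x = a by move=> /contrapT.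
by split=> //; [exact: gf0.1|apply: ghom_refl => //; exact: gf0.1].
Qed.

(** Sets of directions of equal size may be processed in any order, because none of them contains
    another. *)
Lemma kill_list (k : nat) (s : seq {set 'I_n}) f : (k <= c)%N ->
  (forall D, D \in s -> #|D| = k) -> admissible f ->
  (forall D : {set 'I_n}, (#|D| < k)%N -> killed U a f D) ->
  exists2 f', admissible f' & forall D : {set 'I_n},
    (#|D| < k)%N \/ D \in s -> killed U a f' D.
Proof.
move=> kc; elim: s => [|D s IH] hs af kf.
  by exists f => // D [/kf|].
have [|f1 [cf1 f1U hf1] kf1] := IH _ af kf; first by move=> E Es; apply: hs; rewrite inE Es orbT.
have Dk : #|D| = k by apply: hs; rewrite inE eqxx.
have Dc : (#|D| <= c)%N by rewrite Dk.
have kD j : j \in D -> killed U a f1 (D :\ j).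
  by move=> jD; apply: kf1; left; rewrite -Dk (cardsD1 j D) jD.
have [H [cH H0 HU HD Hk]] := kill_stage open_supp supp_opencube hA conn Dc cf1 f1U kD.
exists (fun x => H (1, x)).
  split; last 1 first.
  - by apply: ghom_trans hf1 _; exists H; split.
  - by apply: cont_comp cH; apply: cont_pair; [exact: cont_cst|exact: cont_id].
  - by move=> x; exact: HU.
move=> E; have [->//|ED] := eqVneq E D.
rewrite inE (negbTE ED) /= => hE; apply: Hk; last exact: kf1.
apply/negP => DE; have cE : (#|E| <= #|D|)%N.
  rewrite Dk; case: hE => [/ltnW//|Es]; by rewrite hs // inE Es orbT.
by move: ED; rewrite eq_sym eqEcard DE cE.
Qed.

Lemma kill_below k : (k <= c.+1)%N ->
  exists2 f, admissible f & forall D : {set 'I_n}, (#|D| < k)%N -> killed U a f D.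
Proof.
elim: k => [_|k IH kc]; first by exists f0 => //; exact: admissible0.
have [f af kf] := IH (ltnW kc).
have [|f' af' kf'] := @kill_list k (enum [set D : {set 'I_n} | #|D| == k]) f kc _ af kf.
  by move=> D; rewrite mem_enum inE => /eqP.
exists f' => // D; rewrite ltnS leq_eqVlt => /orP[Dk|Dk]; apply: kf'; last by left.
by right; rewrite mem_enum inE.
Qed.

(** A point of [U] on the grid of its level in some direction [i] is covered by the set of all
    directions but [i], which has been killed. *)
Lemma concentrate : c = n.-1 -> exists2 f, admissible f &
  forall x, f x <> a -> exists m z, valid_cell U [set: 'I_n] m z /\ incell [set: 'I_n] m z x.
Proof.
move=> cn; have [f [cf fU hf] kf] := kill_below (leqnn _).
exists f => // x fx; have Ux : U x by apply: contrapT => /fU.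
have [m lx] := level_ex open_supp Ux.
pose z : {ffun 'I_n -> int} := [ffun i => Num.floor (sc m x i)].
have hx : incell [set: 'I_n] m z x.
  move=> i; rewrite ffunE finset.in_setT.
  have /andP[f1 f2] := floor_itv (sc m x i); rewrite intrD in f2.
  rewrite f2 andbT lt_neqAle f1 andbT; apply/eqP => E; apply: fx.
  have n0 : (0 < n)%N by apply: leq_trans (ltn_ord i).
  apply: (kf ([set: 'I_n] :\ i)) lx _.
    by have := cardsD1 i [set: 'I_n]; rewrite finset.in_setT cardsT card_ord cn; lia.
  move=> j; rewrite !inE andbT negbK => /eqP ->.
  by exists (Num.floor (sc m x i)).
by exists m, z; split => //; exact: level_incell hx lx.
Qed.

End KillAll.

(** * Rearranging boxes *)

(* The [e]-th interval has length [2^-(e+1)]; its left end is the total length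
   of the intervals that precede it in the order given by [kap]. *)
Lemma ordered_intervals (kap : nat -> RR) : exists gl gr : nat -> RR,
  [/\ forall e, 0 <= gl e /\ gr e <= 1, forall e, gl e < gr e,
      forall e e', kap e < kap e' -> gr e <= gl e' &
      forall e e', e <> e' -> gr e <= gl e' \/ gr e' <= gl e].
Proof.
(* Ties of [kap] are broken by the index, so that any two intervals are comparable. *)
pose R i e := (kap i < kap e) || ((kap i == kap e) && (i < e)%N).
pose w (i : nat) : RR := 2^-1 ^+ i.+1.
pose S e N := \sum_(i < N | R i e) w i.
have w0 i : 0 < w i by exact: half_gt0.
have Rirr e : R e e = false by rewrite /R ltxx ltnn andbF.
have Rtr i e e' : R i e -> R e e' -> R i e'.
  move=> /orP[h1|/andP[/eqP h1 h1']] /orP[h2|/andP[/eqP h2 h2']]; rewrite /R.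
  - by rewrite (lt_trans h1 h2).
  - by rewrite -h2 h1.
  - by rewrite h1 h2.
  - by rewrite h1 h2 eqxx (ltn_trans h1' h2') orbT.
have sumw N : \sum_(i < N) w i <= 1.
  suff -> : \sum_(i < N) w i = 1 - 2^-1 ^+ N by have := half_gt0 N; lra.
  elim: N => [|N IH]; first by rewrite big_ord0 expr0 subrr.
  by rewrite big_ord_recr /= IH /w exprS; field.
have S0 e N : 0 <= S e N by apply: sumr_ge0 => i _; exact: ltW.
(* Used twice: with [P] everything it bounds the right ends by 1; with [P] the predecessors of a
   later index it puts the intervals in order. *)
have Sadd e N (P : pred nat) : (forall i, R i e -> P i) -> P e ->
    S e N + w e <= \sum_(i < maxn N e.+1 | P i) w i.
  move=> RP Pe; pose M := maxn N e.+1.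
  have eM : (e < M)%N by rewrite leq_max ltnSn orbT.
  rewrite (bigD1 (Ordinal eM)) //= [leLHS]addrC lerD2l.
  have -> : S e N = \sum_(i < M | R i e && (i < N)%N) w i.
    by rewrite /S (big_ord_widen_cond M (fun i => R i e) w) // leq_maxl.
  rewrite [leLHS]big_mkcond [leRHS]big_mkcond; apply: ler_sum => i _.
  case: ifP => [/andP[Ri _]|_]; last by case: ifP => // _; exact: ltW.
  rewrite RP //= ifT //; apply/eqP => E.
  by move: Ri; rewrite E /= Rirr.
pose gl e := sup [set S e N | N in [set: nat]].
have nS e : [set S e N | N in [set: nat]] !=set0 by exists (S e 0%N), 0%N.
have S1 e N : S e N + w e <= 1.
  by apply: le_trans (sumw (maxn N e.+1)); apply: (@Sadd e N predT).
have hS e : has_ubound [set S e N | N in [set: nat]].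
  by exists 1 => _ [N _ <-]; have := S1 e N; have := w0 e; lra.
have glS e N : S e N <= gl e by have h := ub_le_sup (hS e); apply: h; exists N.
have glu e u : (forall N, S e N <= u) -> gl e <= u.
  by move=> h; apply: (ge_sup (nS e)) => _ [N _ <-]; exact: h.
have glr e e' : R e e' -> gl e + w e <= gl e'.
  move=> ee'; rewrite -lerBrDr; apply: glu => N; rewrite lerBrDr.
  apply: le_trans (glS e' (maxn N e.+1)); apply: (@Sadd e N (R^~ e')) => // i ie; exact: Rtr ie ee'.
exists gl, (fun e => gl e + w e); split.
- move=> e; split; first exact: le_trans (S0 e 0%N) (glS e 0%N).
  by rewrite -lerBrDr; apply: glu => N; rewrite lerBrDr.
- by move=> e; rewrite ltrDl.
- by move=> e e' h; apply: glr; rewrite /R h.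
- move=> e e' ne; have [h|h|h] := ltgtP (kap e) (kap e').
  + by left; apply: glr; rewrite /R h.
  + by right; apply: glr; rewrite /R h.
  + have [h'|h'|//] := ltngtP e e'.
    * by left; apply: glr; rewrite /R h eqxx h' orbT.
    * by right; apply: glr; rewrite /R h eqxx h' orbT.
Qed.

(** If the sides overlapped in every coordinate, the midpoints of the overlaps would form a common
    point. *)
Lemma box_separated n (l r l' r' : 'rV[RR]_n) : box l r -> box l' r' ->
  (forall x : 'rV[RR]_n, (forall i, l 0 i < x 0 i < r 0 i) -> (forall i, l' 0 i < x 0 i < r' 0 i) -> False) ->
  exists d, r 0 d <= l' 0 d \/ r' 0 d <= l 0 d.
Proof.
move=> lr lr' h; apply: contrapT => ne.
have hd d : l' 0 d < r 0 d /\ l 0 d < r' 0 d.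
  by split; rewrite ltNge; apply/negP => hh; apply: ne; exists d; [left|right].
pose x : 'rV[RR]_n := \row_d ((Num.max (l 0 d) (l' 0 d) + Num.min (r 0 d) (r' 0 d)) / 2).
have hx d : Num.max (l 0 d) (l' 0 d) < x 0 d < Num.min (r 0 d) (r' 0 d).
  rewrite mxE; have [h1 h2] := hd d; have := lr d; have := lr' d.
  have : Num.max (l 0 d) (l' 0 d) < Num.min (r 0 d) (r' 0 d).
    by rewrite gt_max !lt_min lr lr' h1 h2.
  move: (Num.max _ _) (Num.min _ _) => u v uv _ _; apply/andP; split; lra.
by apply: (h x) => d; have := hx d; rewrite gt_max lt_min => /andP[/andP[e1 e2] /andP[e3 e4]]; rewrite ?e1 ?e2 ?e3 ?e4.
Qed.

Section Rearrange.
Variables (n : nat) (hn : (2 <= n)%N).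
Variables (A : nat -> topologicalType) (a : forall j, A j).
Hypothesis hA : forall j, hausdorff_space (A j).
Variables (I : countType) (valid : nat -> I -> Prop).
Variable q : forall j, I -> 'rV[RR]_n -> A j.
Hypothesis qc : forall j i, continuous (q j i).
Hypothesis qa : forall j i x, ~ opencube x -> q j i x = a j.
Hypothesis qv : forall j i x, ~ valid j i -> q j i x = a j.
Hypothesis qs : forall j (N : set (A j)), open N -> N (a j) ->
  finite_set [set i | exists x, ~ N (q j i x)].
Variables l r : nat -> I -> 'rV[RR]_n.
Hypothesis lr : boxes valid l r.
Hypothesis lrap : apart valid l r.

Local Notation F l r := (fun x => comb a (fun j => spread a q l r j x)).

Lemma rearrange : exists l' r' : nat -> I -> 'rV[RR]_n,
  [/\ ghom (swedge_pt a : swedgeT a) (@outcube n) (F l r) (F l' r'), boxes valid l' r',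
      apart valid l' r' &
      forall j i d, slabl n j 0 d <= l' j i 0 d /\ r' j i 0 d <= slabr n j 0 d].
Proof.
have n0 : (0 < n)%N by exact: leq_trans hn.
pose d0 := Ordinal n0; pose d1 := Ordinal hn.
pose code (j : nat) (i : I) : nat := pickle (j, i).
have codeI j i j' i' : (j, i) <> (j', i') -> code j i <> code j' i'.
  by move=> ne E; apply: ne; exact: (pcan_inj pickleK) E.
(* Twice the midpoint of the first side of the box. *)
pose kap (e : nat) : RR := if pickle_inv e is Some k then l k.1 k.2 0 d0 + r k.1 k.2 0 d0 else 0.
have kapE j i : kap (code j i) = l j i 0 d0 + r j i 0 d0 by rewrite /kap pickleK_inv.
have [gl [gr [g01 glr gmon gsep]]] := ordered_intervals kap.
(* The slab of [j] has width [2^-(j+1)]; it is divided among the [i] in the way the unit interval is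
   divided among the slabs. *)
pose tl j (i : I) : RR := 1 - 2^-1 ^+ j + 2^-1 ^+ j.+1 * (1 - 2^-1 ^+ pickle i).
pose tr j (i : I) : RR := 1 - 2^-1 ^+ j + 2^-1 ^+ j.+1 * (1 - 2^-1 ^+ (pickle i).+1).
have hS j : 2^-1 ^+ j.+1 = 2^-1 ^+ j / 2 :> RR by rewrite exprS mulrC.
have tlr j i : tl j i < tr j i.
  rewrite /tl /tr ltrD2l ltr_pM2l ?half_gt0 // ltrD2l ltrN2 [ltLHS]hS.
  by have := half_gt0 (pickle i); lra.
have tin j i : 1 - 2^-1 ^+ j <= tl j i /\ tr j i <= 1 - 2^-1 ^+ j.+1.
  rewrite /tl /tr; have := half_gt0 j.+1; have := half_le1 (pickle i).
  have := half_gt0 (pickle i).+1; rewrite (hS j).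
  move: (2^-1 ^+ j) (2^-1 ^+ pickle i) (2^-1 ^+ (pickle i).+1) => u v w w0 v1 u0.
  by split; nra.
have tsep j i j' i' : (j, i) <> (j', i') -> tr j i <= tl j' i' \/ tr j' i' <= tl j i.
  have pm k k' : (k < k')%N -> 2^-1 ^+ k' <= 2^-1 ^+ k.+1 :> RR.
    by move=> kk; apply: ler_wiXn2l => //; lra.
  move=> ne; have [h1 h2] := tin j i; have [h3 h4] := tin j' i'.
  have [jj|jj|jj] := ltngtP j j'.
  - by left; apply: (le_trans h2); apply: le_trans h3; rewrite lerD2l lerN2 pm.
  - by right; apply: (le_trans h4); apply: le_trans h1; rewrite lerD2l lerN2 pm.
  - rewrite -jj; have ii : pickle i <> pickle i'.
      by move=> /(pcan_inj pickleK) E; apply: ne; rewrite jj E.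
    have [pp|pp|//] := ltngtP (pickle i) (pickle i'); [left|right];
      by rewrite lerD2l ler_pM2l ?half_gt0 // lerD2l lerN2 pm.
pose l1 j i : 'rV[RR]_n := \row_d (if d == d0 then gl (code j i) else l j i 0 d).
pose r1 j i : 'rV[RR]_n := \row_d (if d == d0 then gr (code j i) else r j i 0 d).
pose l2 j i : 'rV[RR]_n := \row_d (if d == d0 then gl (code j i) else if d == d1 then tl j i else 0).
pose r2 j i : 'rV[RR]_n := \row_d (if d == d0 then gr (code j i) else if d == d1 then tr j i else 1).
pose l3 j i : 'rV[RR]_n := \row_d (if d == d1 then tl j i else 0).
pose r3 j i : 'rV[RR]_n := \row_d (if d == d1 then tr j i else 1).
have t01 j i : 0 <= tl j i /\ tr j i <= 1.
  have [h1 h2] := tin j i; have := half_le1 j; have := half_gt0 j.+1.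
  by split; lra.
have b1 : boxes valid l1 r1.
  split=> j i => [d|vi d]; rewrite !mxE; case: eqP => _ //; first exact: lr.1.
  exact: lr.2.
have b2 : boxes valid l2 r2.
  split=> j i => [d|vi d]; rewrite !mxE; case: eqP => _ //; case: eqP => _ //.
have b3 : boxes valid l3 r3.
  by split=> j i => [d|vi d]; rewrite !mxE; case: eqP => _ //.
exists l3, r3; split => //.
- apply: (@ghom_trans _ _ _ _ _ (F l1 r1)).
    apply: (spread_isotopy hA qc qa qv qs lr b1) => j i j' i' v v' ne.
    (* Of two boxes separated in the first coordinate, the lower one has the smaller midpoint, so
       the new intervals come in the same order. Separation in any other coordinate is untouched by
       this move. *)
    have [d hd] := lrap v v' ne; exists d; rewrite !mxE; case: eqP => [dE|_]; last first.
      by case: hd => h; [left|right].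
    have hl := lr.1 j i d; have hl' := lr.1 j' i' d; rewrite dE in hd hl hl' *.
    case: hd => h; [left|right]; split => //; apply: gmon; rewrite !kapE; lra.
  apply: (@ghom_trans _ _ _ _ _ (F l2 r2)).
    apply: (spread_isotopy hA qc qa qv qs b1 b2) => j i j' i' v v' ne; exists d0; rewrite !mxE eqxx.
    by case: (gsep _ _ (codeI _ _ _ _ ne)) => h; [left|right].
  apply: (spread_isotopy hA qc qa qv qs b2 b3) => j i j' i' v v' ne; exists d1; rewrite !mxE eqxx /=.
  by case: (tsep _ _ _ _ ne) => h; [left|right].
- move=> j i j' i' v v' ne; exists d1; rewrite !mxE eqxx; exact: tsep.
- move=> j i d; rewrite !mxE -[_ == d1]/(val d == 1%N); case: ifP => // _.
Qed.

End Rearrange.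

(** * Deforming a map into the image of the splitting *)

Section Factor.
Variables (n : nat) (hn : (2 <= n)%N).
Variables (A : nat -> topologicalType) (a : forall j, A j).
Hypothesis hA : forall j, hausdorff_space (A j).
Local Notation pt := (swedge_pt a : swedgeT a).
Local Notation retr := (@swedge_retr A a).
Local Notation cell := (nat * {ffun 'I_n -> int})%type.
Local Notation full := [set: 'I_n]%SET.

Definition stretch j (y : 'rV[RR]_n) : 'rV[RR]_n :=
  \row_i (slabl n j 0 i + y 0 i * (slabr n j 0 i - slabl n j 0 i)).

Lemma ubox_stretch j y : ubox (slabl n j) (slabr n j) (stretch j y) = y.
Proof.
apply/rowP => i; rewrite mxE [stretch j y 0 i]mxE addrC addKr mulfK //.
by rewrite subr_eq0 gt_eqF // slab_box.
Qed.

Lemma stretch_ubox j x : stretch j (ubox (slabl n j) (slabr n j) x) = x.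
Proof.
apply/rowP => i; rewrite mxE [ubox _ _ x 0 i]mxE divfK; first by rewrite addrC subrK.
by rewrite subr_eq0 gt_eqF // slab_box.
Qed.

(** A family supported in the slabs is equal, not just homotopic, to a value of [sect]: each slab is
    rescaled to the cube. *)
Lemma slab_supported_sect (G : forall j, 'rV[RR]_n -> A j) :
  (forall j, continuous (G j)) ->
  (forall j x, G j x <> a j -> opencube (ubox (slabl n j) (slabr n j) x)) ->
  exists p, (forall j, nloop (a j) (p j)) /\
    sect a p = (fun x => comb a (fun j => G j x)).
Proof.
move=> cG hG; exists (fun j y => G j (stretch j y)).
have out j x : ~ opencube (ubox (slabl n j) (slabr n j) x) -> G j x = a j.
  by move=> h; apply: contrapT => /hG.
split => [j|].
  apply: gloop_nloop; split => [|y oy]; last by apply: out; rewrite ubox_stretch.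
  apply: cont_comp (cG j); apply: cont_row => i; apply: cont_add; first exact: cont_cst.
  by apply: cont_mul; [apply: cont_coord; exact: cont_id|exact: cont_cst].
apply/funext => x; congr comb; apply: functional_extensionality_dep => j.
have [ox|ox] := pselect (opencube (ubox (slabl n j) (slabr n j) x)).
  by rewrite clampv_id ?stretch_ubox //; exact: opencube_cube.
rewrite [RHS]out // out // ubox_stretch.
by move=> /clampv_opencube.
Qed.

Definition cell_left (e : cell) : 'rV[RR]_n := \row_i ((e.2 i)%:~R / 2 ^+ e.1).
Definition cell_right (e : cell) : 'rV[RR]_n := \row_i (((e.2 i)%:~R + 1) / 2 ^+ e.1).

Lemma cell_box e : box (cell_left e) (cell_right e).
Proof. by move=> i; rewrite !mxE ltr_pM2r ?invr_gt0 ?sc_gt0 // ltrDl. Qed.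

Lemma incell_box e x : incell full e.1 e.2 x <->
  forall i, cell_left e 0 i < x 0 i < cell_right e 0 i.
Proof.
split => h i; have := h i; rewrite finset.in_setT !mxE ltr_pdivrMr ?sc_gt0 //.
  by rewrite ltr_pdivlMr ?sc_gt0.
by rewrite ltr_pdivlMr ?sc_gt0.
Qed.

Lemma incell_ubox e x : incell full e.1 e.2 x <->
  opencube (ubox (cell_left e) (cell_right e) x).
Proof.
by rewrite incell_box; split; move/(ubox_opencube _ (cell_box e)).
Qed.

Lemma cell_inunit (U : set 'rV[RR]_n) (e : cell) : (forall x, U x -> opencube x) ->
  valid_cell U full e.1 e.2 -> inunit (cell_left e) (cell_right e).
Proof.
move=> UC [/onlevel_sub/UC oc _] i; have := oc i.
rewrite !mxE finset.in_setT ltr_pdivrMr ?sc_gt0 // mul1r.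
rewrite ltr_pdivlMr ?sc_gt0 // mul0r => /andP[h1 h2].
have z0 : (-1)%:~R < (e.2 i)%:~R :> RR by rewrite -[(-1)%:~R]/(-1 : RR); lra.
have pE : (2 ^+ e.1 : int)%:~R = 2 ^+ e.1 :> RR by rewrite rmorphXn.
have z1 : (e.2 i)%:~R < (2 ^+ e.1 : int)%:~R :> RR by rewrite pE; lra.
split.
  rewrite ler_pdivlMr ?sc_gt0 // mul0r (ler_int _ 0).
  by move: z0; rewrite ltr_int; lia.
by rewrite ler_pdivrMr ?sc_gt0 // mul1r; rewrite -pE; exact: intr_gtS.
Qed.

Lemma factor_through_sect (f : 'rV[RR]_n -> swedgeT a) : (forall j, seq_connected n.-1 (a j)) -> gloop pt f ->
  exists p, (forall j, nloop (a j) (p j)) /\ ghom pt (@outcube n) f (sect a p).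
Proof.
move=> conn [cf fpt].
pose f0 j x := retr j (f x).
have gf0 j : gloop (a j) (f0 j).
  split; first exact: cont_comp cf (@swedge_retr_continuous _ _ j).
  by move=> x ox; rewrite /f0 fpt // swedge_retr_pt.
pose U j := [set x | f0 j x <> a j].
have UC j x : U j x -> opencube x by exact: supp_opencube (gf0 j) x.
have Udisj i j x : U i x -> U j x -> i = j by exact: swedge_retr_disj.
have E j := concentrate (@hA j) (conn j) (gf0 j) erefl.
pose g j := projT1 (cid2 (E j)).
have gad j : admissible (a j) (f0 j) (g j) by rewrite /g; case: cid2.
have gcell j x : g j x <> a j -> exists m z, valid_cell (U j) full m z /\ incell full m z x.
  by rewrite /g; case: cid2 => g' ? h; exact: h.
have cg j : continuous (g j) by have [] := gad j.
have gU j x : ~ U j x -> g j x = a j by have [_ h _] := gad j; exact: h.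
have hg j : ghom (a j) (~` U j) (f0 j) (g j) by have [] := gad j.
have step1 : ghom pt (@outcube n) f (fun x => comb a (fun j => g j x)).
  pose H j := projT1 (cid (hg j)).
  have hH j : [/\ continuous (H j), (forall x, H j (0, x) = f0 j x),
    (forall x, H j (1, x) = g j x) & forall t x, (~` U j) x -> H j (t, x) = a j].
    exact: projT2 (cid (hg j)).
  have HU j t x : H j (t, x) <> a j -> U j x.
    by move=> h; apply: contrapT => nU; apply: h; have [_ _ _] := hH j; apply.
  exists (fun p => comb a (fun j => H j p)); split.
  - apply: (comb_continuous hA) => [i j [t x] /HU h1 /HU h2|j]; first exact: Udisj h1 h2.
    by have [] := hH j.
  - move=> x; rewrite -[RHS]comb_retr; congr comb.
    by apply: functional_extensionality_dep => j; have [_ -> _ _] := hH j.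
  - move=> x; congr comb; apply: functional_extensionality_dep => j.
    by have [_ _ -> _] := hH j.
  - move=> t x ox; apply: comb_pt => j; have [_ _ _] := hH j; apply.
    by move=> /UC.
pose valid j (e : cell) := valid_cell (U j) full e.1 e.2.
pose corner (e : cell) (y : 'rV[RR]_n) : 'rV[RR]_n :=
  \row_i (((e.2 i)%:~R + y 0 i) / 2 ^+ e.1).
(* The restriction of [g j] to a closed cell, rescaled to the unit cube and extended by clamping. *)
pose q j (e : cell) y := if pselect (valid j e) then g j (corner e (clampv y)) else a j.
have corner_ubox e x : corner e (ubox (cell_left e) (cell_right e) x) = x.
  apply/rowP => i; rewrite !mxE.
  have := sc_gt0 e.1; move: (2 ^+ e.1) (e.2 i)%:~R => S Z S0.
  by rewrite [(Z + 1) / S]mulrDl mul1r [Z / S + _]addrC addrK; field; rewrite gt_eqF.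
have sc_corner e y i : sc e.1 (corner e y) i = (e.2 i)%:~R + y 0 i.
  by rewrite /sc mxE scK.
have qc j e : continuous (q j e).
  rewrite /q; case: pselect => v; last exact: cont_cst.
  apply: cont_comp (cg j); apply: cont_row => i; apply: cont_mul; last exact: cont_cst.
  apply: cont_add; first exact: cont_cst.
  by apply: cont_coord; apply: cont_clampv; exact: cont_id.
have qa j e y : ~ opencube y -> q j e y = a j.
  (* A nontrivial value would put the point into an open [n]-cell, off the grid of its level in
     every direction; on a face of a valid cell, however, the coordinate [d] is on that grid. *)
  rewrite /q; case: pselect => // v /clampv_bdry[cy [d yd]].
  apply: contrapT => /gcell[m' [z' [v' hx]]].
  set x := corner e (clampv y) in hx.
  have lx := incell_level hx v'.
  have [] : ongrid m' x d.
    apply: (cell_boundary (j := d) v) lx _ _ => [i|||].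
    - rewrite finset.in_setT sc_corner.
      by have /andP[? ?] := cy i; apply/andP; split; lra.
    - by rewrite finset.in_setT.
    - by rewrite sc_corner; case: yd => ->; [left; rewrite addr0|right].
    - by rewrite !inE eqxx.
  move=> C EC; have := hx d; rewrite finset.in_setT EC => /andP[h1 h2].
  by have := intr_ltS h2; lra.
have qv j e y : ~ valid j e -> q j e y = a j by rewrite /q; case: pselect.
have corner_in e y : opencube y -> incell full e.1 e.2 (corner e y).
  move=> oy i; rewrite finset.in_setT sc_corner.
  by have /andP[? ?] := oy i; apply/andP; split; lra.
have qs j (N : set (A j)) : open N -> N (a j) -> finite_set [set e | exists x, ~ N (q j e x)].
  move=> oN Na; have := finite_bad_cells (@UC j) (@hA j) (cg j) (gU j) oN Na full.
  apply: sub_finite_set => e /= [y nN].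
  have oy : opencube y by apply: contrapT => oy; apply: nN; rewrite qa.
  move: nN; rewrite /q; case: pselect => //= v nN; split => //.
  exists (corner e (clampv y)); split => //; apply: incell_diamond.
  by rewrite clampv_id; [exact: corner_in|exact: opencube_cube].
pose l (j : nat) (e : cell) := cell_left e; pose r (j : nat) (e : cell) := cell_right e.
have blr : boxes valid l r.
  split => j e; first exact: cell_box.
  by move=> v; exact: cell_inunit (@UC j) v.
have alr : apart valid l r.
  (* Cells of different [U j] are disjoint because the [U j] are, cells of the same one because
     their diamonds are. *)
  move=> j e j' e' v v' ne; apply: box_separated; [exact: cell_box|exact: cell_box|].
  move=> x /incell_box h /incell_box h'; apply: ne.
  have Ux := onlevel_sub (incell_level h v).1; have Ux' := onlevel_sub (incell_level h' v').1.
  have jj : j = j' by exact: Udisj Ux Ux'.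
  subst j'; congr pair.
  have := diamond_disj v v' (incell_diamond h) (incell_diamond h').
  by case: e e' {v v' h h'} => ? ? [? ?].
have spread_g j x : spread a q l r j x = g j x.
  have ev e : valid j e -> opencube (ubox (cell_left e) (cell_right e) x) ->
      spread a q l r j x = g j x.
    move=> v o; rewrite (spreadE qa qv blr alr v o) /q; case: pselect => //= _.
    by rewrite clampv_id ?corner_ubox //; exact: opencube_cube.
  have [gx|/gcell[m [z [v hx]]]] := pselect (g j x = a j); last first.
    by apply: (ev (m, z)) => //; apply/incell_ubox.
  apply: contrapT => ne; have [] := @spread_neq _ _ _ _ _ _ qa qv l r j x.
    by move=> E'; apply: ne; rewrite E' gx.
  by move=> e v o; apply: ne; exact: ev v o.
have [l' [r' [h12 b' ap' slab]]] := rearrange hn hA qc qa qv qs blr alr.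
have cs j : continuous (spread a q l' r' j).
  (* Continuity for fixed boxes is that of a constant motion, restricted to time 0. *)
  have cl (u : nat -> cell -> 'rV[RR]_n) (k : nat) (e : cell) :
    continuous (fun _ : RR => u k e) by exact: cont_cst.
  have := spread_move hA qc qa qv qs (l := fun _ => l') (r := fun _ => r')
    (fun _ => b') (fun _ => ap') (cl l') (cl r') (j := j).
  move=> cm; apply: (@cont_comp _ _ _ (fun x => (0 : RR, x)) _ _ cm).
  by apply: cont_pair; [exact: cont_cst|exact: cont_id].
have [|p [lp E3]] := @slab_supported_sect (spread a q l' r') cs.
  move=> j x /(spread_neq qa qv)[e v] /(ubox_opencube _ (b'.1 j e)) h.
  apply/ubox_opencube => [|d]; first exact: slab_box.
  by have := h d; have [] := slab j e d; lra.
exists p; split => //; apply: ghom_trans step1 _; rewrite E3.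
have E1 : (fun x => comb a (fun j => g j x)) = fun x => comb a (fun j => spread a q l r j x).
  apply/funext => x; congr comb; apply: functional_extensionality_dep => j.
  by rewrite spread_g.
by rewrite E1.
Qed.

Lemma homotopic_sect (f : 'rV[RR]_n -> swedgeT a) : (forall j, seq_connected n.-1 (a j)) -> nloop pt f ->
  exists p, [/\ forall j, nloop (a j) (p j), nhomotopic pt f (sect a p) &
    forall j, nhomotopic (a j) (p j) (retr j \o f)].
Proof.
move=> conn lf; have [p [lp hp]] := factor_through_sect conn (nloop_gloop lf).
exists p; split => //.
  by apply: ghom_nhomotopic hp => x cx //; rewrite clampv_id.
move=> j; apply: nhomotopic_trans (nhomotopic_sym (retr_sect_homotopic hn j lp)) _.
apply: nhomotopic_sym; have [H [cH H0 H1 HP]] := hp.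
apply: (ghom_nhomotopic (f' := fun x => retr j (f (clampv x)))
                        (g' := fun x => retr j (sect a p x))) => [x cx|//|].
  by rewrite /= clampv_id.
exists (fun p => retr j (H p)); split.
- exact: cont_comp cH (@swedge_retr_continuous _ _ j).
- by move=> x; rewrite H0.
- by move=> x; rewrite H1.
- by move=> t x ox; rewrite HP // swedge_retr_pt.
Qed.

End Factor.

Theorem theorem4p25 (n : nat) (hn : (2 <= n)%N)
    (A : nat -> topologicalType) (a : forall j, A j)
    (hA : forall j, hausdorff_space (A j)) :
  let Y := swedgeT a in
  let b0 : Y := swedge_pt a in
  let r : forall j, Y -> A j := @swedge_retr A a in
  (* phi : pi_n(Y,b0) -> prod_j pi_n(A_j,a_j), [f] |-> ([r_j o f])_j,
     is a well-defined homomorphism *)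
  [/\ (forall f : 'rV[RR]_n -> Y, nloop b0 f -> forall j, nloop (a j) (r j \o f)),
      (forall f g : 'rV[RR]_n -> Y, nloop b0 f -> nloop b0 g ->
         nhomotopic b0 f g -> forall j, nhomotopic (a j) (r j \o f) (r j \o g)) &
      (forall (f g : 'rV[RR]_n -> Y) j,
         r j \o nconcat f g = nconcat (r j \o f) (r j \o g))]
  /\
  (* phi is a split epimorphism: a homomorphic section s *)
  (exists s : (forall j, 'rV[RR]_n -> A j) -> ('rV[RR]_n -> Y),
    [/\ (forall f, (forall j, nloop (a j) (f j)) -> nloop b0 (s f)),
        (forall f g, (forall j, nloop (a j) (f j)) -> (forall j, nloop (a j) (g j)) ->
           (forall j, nhomotopic (a j) (f j) (g j)) -> nhomotopic b0 (s f) (s g)),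
        (forall f g, (forall j, nloop (a j) (f j)) -> (forall j, nloop (a j) (g j)) ->
           nhomotopic b0 (s (fun j => nconcat (f j) (g j))) (nconcat (s f) (s g))) &
        (forall f, (forall j, nloop (a j) (f j)) ->
           forall j, nhomotopic (a j) (r j \o s f) (f j))])
  /\
  (* if every (A_j, a_j) is sequentially (n-1)-connected, phi is injective
     (hence, being a split epimorphism, an isomorphism) *)
  ((forall j, seq_connected n.-1 (a j)) ->
    forall f g : 'rV[RR]_n -> Y, nloop b0 f -> nloop b0 g ->
      (forall j, nhomotopic (a j) (r j \o f) (r j \o g)) -> nhomotopic b0 f g).
Proof.
move=> Y b0 r; have n0 : (0 < n)%N by exact: leq_trans hn.
have lr j f : nloop b0 f -> nloop (a j) (r j \o f).
  move=> [cf fb]; split; last by move=> x /fb E; rewrite /= E; exact: swedge_retr_pt.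
  exact: within_cont_comp cf (@swedge_retr_continuous _ _ j).
have hr j f g : nhomotopic b0 f g -> nhomotopic (a j) (r j \o f) (r j \o g).
  move=> [H [cH H01 Hb]]; exists (fun p => r j (H p)); split.
  - exact: within_cont_comp cH (@swedge_retr_continuous _ _ j).
  - by move=> x /H01[-> ->].
  - by move=> t x ut bx; rewrite Hb //; exact: swedge_retr_pt.
split; [|split].
- split => [f lf j|f g _ _ fg j|f g j]; [exact: lr|exact: hr|].
  by apply/funext => x; rewrite /nconcat /=; case: ifP.
- exists (sect a); split.
  + by move=> f lf; apply: gloop_nloop; exact: sect_gloop.
  + move=> f g lf lg fg; apply: (ghom_nhomotopic (f' := sect a f) (g' := sect a g)) => //.
    exact: sect_ghom.
  + move=> f g lf lg; apply: nhomotopic_eq => [|x cx]; last exact: sect_nconcat.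
    by apply: gloop_nloop; apply: sect_gloop => // j; exact: nconcat_nloop.
  + by move=> f lf j; exact: retr_sect_homotopic.
- move=> conn f g lf lg fg.
  have [p [lp fp pf]] := homotopic_sect hn hA conn lf.
  have [p' [lp' gp' pg]] := homotopic_sect hn hA conn lg.
  apply: (nhomotopic_trans fp); apply: (nhomotopic_trans _ (nhomotopic_sym gp')).
  apply: (ghom_nhomotopic (f' := sect a p) (g' := sect a p')) => //.
  apply: sect_ghom => // j; apply: (nhomotopic_trans (pf j)).
  exact: nhomotopic_trans (fg j) (nhomotopic_sym (pg j)).
Qed.
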